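(* Let $A$ be a real $n\times n$ matrix, $B$ a real $n\times d$ matrix with $\operatorname{Rank}(B)=n$, and let $L$ be a Lévy process on $\mathbb{R}^d$ with Lévy measure $\nu$ satisfying $\nu\ge\nu_0:=\rho_0(z)\,\mathrm{d}z$, where $\rho_0>0$ is measurable on $\mathbb{R}^d$ and $\lambda_0:=\nu_0(\mathbb{R}^d)\in(0,\infty)$. Let $P_t^1f(x)=\mathbb{E}\{f(X_t^x)1_{\{\tau_1\le t\}}\}$, where $X^x$ solves $\mathrm{d}X_t^x=AX_t^x\,\mathrm{d}t+B\,\mathrm{d}L_t$, $X_0^x=x$, and $\tau_1$ is the first jump time of the compound Poisson part $L^0$ of $L$ with Lévy measure $\nu_0$. There exists a constant $c=c(B)>0$ (depending on $B$) such that if for some $p>1$ $$V_p(r):=\frac{1}{\lambda_0}\sup_{|z'|\le r}\int_{\mathbb{R}^d}\frac{\rho_0(z-z')^{p/(p-1)}}{\rho_0(z)^{1/(p-1)}}\,\mathrm{d}z<\infty,\qquad r\ge 0,$$ then for any positive measurable function $f$ on $\mathbb{R}^n$, $$(P_t^1f(x))^p\le (P_t^1f^p(y))\left\{(1-e^{-\lambda_0t})\,V_p\big(c\,e^{\|A\|t}|x-y|\big)\right\}^{p-1},\qquad x,y\in\mathbb{R}^n,\ t>0.$$ Consequently, for all $t>0$, $$\|P_t^1\|_{p\to\infty}\le(1-e^{-\lambda_0t})\,e^{\|A\|t/p}\left\{\int_{\mathbb{R}^n}\frac{\mathrm{d}x}{V_p(c\,e^{\|A\|t}|x|)^{p-1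}}\right\}^{-1/p}<\infty.$$
   Context: A Lévy measure $\nu$ on $\mathbb{R}^d$ satisfies $\nu(\{0\})=0$ and $\int_{\mathbb{R}^d}(|z|^2\wedge1)\,\nu(\mathrm{d}z)<\infty$. With $b\in\mathbb{R}^d$ and $Q$ a non-negatively definite $d\times d$ matrix, $L$ is the Lévy process (started at $0$) generated by $$\mathscr{L}f=\langle b,\nabla f\rangle+\operatorname{Tr}(Q\nabla^2f)+\int_{\mathbb{R}^d}\{f(z+\cdot)-f-\langle\nabla f,z\rangle1_{\{|z|\le1\}}\}\,\nu(\mathrm{d}z),\qquad f\in C_b^2(\mathbb{R}^d).$$ It is decomposed as $L_t=L_t^1+L_t^0$ with $L^1$ and $L^0$ independent, where $L^0$ is the compound Poisson process with Lévy measure $\nu_0$, i.e. with generator $\mathscr{L}_0f=\int_{\mathbb{R}^d}(f(\cdot+z)-f)\,\nu_0(\mathrm{d}z)$, and $L^1$ is the Lévy process with Lévy measure $\nu-\nu_0$ generated by $\mathscr{L}-\mathscr{L}_0$. The solution is $X_t^x=e^{At}x+\int_0^te^{A(t-s)}B\,\mathrm{d}L_s$. $\|A\|$ is the operator norm of the matrix $A$, and $\|\cdot\|_{p\to q}$ is the operator norm from $L^p(\mathbb{R}^n;\mathrm{d}x)$ to $L^q(\mathbb{R}^n;\mathrm{d}x)$. *)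

(* Defs.v *)
From HB Require Import structures.
From mathcomp Require Import all_boot all_order all_algebra.
From mathcomp Require Import all_classical all_reals all_analysis.

Set Implicit Arguments.
Unset Strict Implicit.
Unset Printing Implicit Defensive.

Import Order.TTheory GRing.Theory Num.Theory.
Import numFieldNormedType.Exports.

Local Open Scope classical_set_scope.
Local Open Scope ring_scope.

(* Vectors of R^n are columns ['cV[R]_n].  The norm [`|v|] that the library puts
   on matrices is the sup norm (and is used here only for its topology), so the
   Euclidean norm has to be defined. *)
Definition dotp (R : realType) n (u v : 'cV[R]_n) : R := \sum_i u i 0 * v i 0.

Definition enorm (R : realType) n (v : 'cV[R]_n) : R := Num.sqrt (dotp v v).

Definition opnorm (R : realType) m n (A : 'M[R]_(m, n)) : R :=
  sup [set enorm (A *m v) | v in [set v | enorm v <= 1]].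

(* The product sigma-algebra, i.e. the Borel sigma-algebra of R^(m * n). *)
Section matrix_measurable.
Context (R : realType) (m n : nat).

Definition mx_cylinders : set_system 'M[R]_(m, n) :=
  [set C | exists i j (U : set R),
    measurable U /\ C = [set M : 'M[R]_(m, n) | U (M i j)]].

Definition mx_display : measure_display. Proof. exact. Qed.

Let mx_set0 : <<s mx_cylinders >> set0.
Proof. exact: sigma_algebra0. Qed.

Let mx_setC A : <<s mx_cylinders >> A -> <<s mx_cylinders >> (~` A).
Proof. exact: sigma_algebraC. Qed.

Let mx_bigcup (F : (set 'M[R]_(m, n))^nat) :
  (forall i, <<s mx_cylinders >> (F i)) ->
  <<s mx_cylinders >> (\bigcup_i F i).
Proof. exact: sigma_algebra_bigcup. Qed.

HB.instance Definition _ := @isMeasurable.Build mx_display 'M[R]_(m, n)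
  <<s mx_cylinders >> mx_set0 mx_setC mx_bigcup.

End matrix_measurable.

(* Lebesgue measure on R^n, as the n-fold product of Lebesgue measure on R. *)
Section lebesgue_cV.
Context (R : realType).

Definition consv n (p : measurableTypeR R * 'cV[R]_n) : 'cV[R]_n.+1 :=
  col_mx (p.1 : R)%:M p.2.

Lemma measurable_consv n : measurable_fun setT (@consv n).
Proof.
apply: (@measurability _ _ _ _ _ _ (@mx_cylinders R n.+1 1)) => //.
move=> _ [_ [i [j [U [mU ->]]]] <-]; rewrite setTI.
case: (split_ordP (i : 'I_(1 + n))) => k ->.
- rewrite [X in measurable X](_ : _ = fst @^-1` U).
    by rewrite -[X in measurable X]setTI; exact: measurable_fst.
  apply/funext => p; congr (U _).
  by rewrite [LHS](col_mxEu (p.1 : R)%:M p.2) !ord1 mxE.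
- rewrite [X in measurable X](_ : _ = snd @^-1` [set v : 'cV[R]_n | U (v k j)]).
    rewrite -[X in measurable X]setTI; apply: measurable_snd => //.
    by apply: sub_sigma_algebra; exists k, j, U.
  by apply/funext => p; congr (U _); exact: (col_mxEd (p.1 : R)%:M p.2).
Qed.

Section step.
Local Open Scope ereal_scope.
Variables (n : nat) (mu : {measure set 'cV[R]_n -> \bar R}).

Definition lebesgue_step : set 'cV[R]_n.+1 -> \bar R :=
  pushforward (lebesgue_measure \x^ mu) (@consv n).

Let mu' : {measure set _ -> \bar R} :=
  measure_function_pushforward__canonical__measure_function_Measure
    (lebesgue_measure \x^ mu) (@measurable_consv n).

Let step0 : lebesgue_step set0 = 0. Proof. exact: (measure0 mu'). Qed.

Let step_ge0 A : 0 <= lebesgue_step A. Proof. exact: (measure_ge0 mu'). Qed.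

Let step_sigma_additive : semi_sigma_additive lebesgue_step.
Proof. exact: (@measure_semi_sigma_additive _ _ _ mu'). Qed.

HB.instance Definition _ := isMeasure.Build _ _ _ lebesgue_step
  step0 step_ge0 step_sigma_additive.

End step.

Fixpoint lebesgue_cV n : {measure set 'cV[R]_n -> \bar R} :=
  if n is m.+1 then lebesgue_step (lebesgue_cV m) else \d_(0 : 'cV[R]_0).

End lebesgue_cV.

Section generator.
Context (R : realType) (d : nat).
Implicit Types (f : 'cV[R]_d -> R) (x z : 'cV[R]_d).

Definition basis_vec (i : 'I_d) : 'cV[R]_d := delta_mx i 0.

Definition grad f x : 'cV[R]_d := \col_i 'D_(basis_vec i) f x.

Definition hessian f x : 'M[R]_d :=
  \matrix_(i, j) 'D_(basis_vec i) (fun y => 'D_(basis_vec j) f y) x.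

Definition Cb f := continuous f /\ exists M, forall x, `|f x| <= M.

Definition Cb2 f :=
  [/\ Cb f,
      forall i, (forall x, derivable f x (basis_vec i)) /\
                Cb (fun x => grad f x i 0) &
      forall i j, (forall x, derivable (fun y => grad f y j 0) x (basis_vec i)) /\
                  Cb (fun x => hessian f x i j)].

Definition levy_generator (b : 'cV[R]_d) (Q : 'M[R]_d)
    (nu : {measure set 'cV[R]_d -> \bar R}) f x : R :=
  dotp b (grad f x) + \tr (Q *m hessian f x) +
  \int[nu]_z (f (z + x) - f x - dotp (grad f x) z * (enorm z <= 1)%R%:R).

Definition jump_generator (nu0 : {measure set 'cV[R]_d -> \bar R}) f x : R :=
  \int[nu0]_z (f (x + z) - f x).

Definition levy_measure (nu : {measure set 'cV[R]_d -> \bar R}) :=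
  nu [set 0] = 0%E /\
  (\int[nu]_z (Num.min (enorm z ^+ 2) 1)%:E < +oo)%E.

Definition nonneg_definite (Q : 'M[R]_d) :=
  forall v : 'cV[R]_d, 0 <= dotp v (Q *m v).

End generator.

(* Processes are indexed by R; only their values at times t >= 0 matter. *)
Section paths.
Context (R : realType) (d : nat).
Implicit Types y : R -> 'cV[R]_d.

Definition cadlag y :=
  (forall t, 0 <= t -> y s @[s --> t^'+] --> y t) /\
  (forall t, 0 < t -> cvg (y s @[s --> t^'-])).

Definition jump_at y t := ~ (y s @[s --> t^'-] --> y t).

Definition first_jump_time y : \bar R :=
  ereal_inf [set t%:E | t in [set t | 0 < t /\ jump_at y t]].

End paths.

Section processes.
Context dO (Omega : measurableType dO) (R : realType) (P : probability Omega R).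

Definition process_events d (L : R -> Omega -> 'cV[R]_d) : set_system Omega :=
  [set C | exists t (E : set 'cV[R]_d),
    [/\ 0 <= t, measurable E & C = L t @^-1` E]].

Definition independent_processes d1 d2 (L : R -> Omega -> 'cV[R]_d1)
    (L' : R -> Omega -> 'cV[R]_d2) :=
  forall C C', <<s process_events L >> C -> <<s process_events L' >> C' ->
    P (C `&` C') = (P C * P C')%E.

Definition independent_increments d (L : R -> Omega -> 'cV[R]_d) :=
  forall (t : nat -> R) (k : nat) (E : nat -> set 'cV[R]_d),
    0 <= t 0%N -> (forall i, t i <= t i.+1) -> (forall i, measurable (E i)) ->
    fine (P (\bigcap_(i < k) [set w | E i (L (t i.+1) w - L (t i) w)])) =
    \prod_(i < k) fine (P [set w | E i (L (t i.+1) w - L (t i) w)]).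

Definition stationary_increments d (L : R -> Omega -> 'cV[R]_d) :=
  forall s t (E : set 'cV[R]_d), 0 <= s -> 0 <= t -> measurable E ->
    P [set w | E (L (s + t) w - L s w)] = P [set w | E (L t w)].

Definition levy_process d (L : R -> Omega -> 'cV[R]_d) :=
  [/\ forall t, 0 <= t -> measurable_fun setT (L t),
      {ae P, forall w, L 0 w = 0},
      independent_increments L,
      stationary_increments L &
      {ae P, forall w, cadlag (L ^~ w)}].

Definition generated_by d (L : R -> Omega -> 'cV[R]_d)
    (G : ('cV[R]_d -> R) -> 'cV[R]_d -> R) :=
  forall f, Cb2 f -> forall x,
    ((\int[P]_w f (x + L t w)) - f x) / t @[t --> 0^'+] --> G f x.

(* [L0 t] is the sum of the jumps [xi i] that have occurred by time [t]; the jump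
   times are the partial sums of the waiting times [T i]. *)
Definition compound_poisson d (nu0 : {measure set 'cV[R]_d -> \bar R})
    (L0 : R -> Omega -> 'cV[R]_d) :=
  (forall t, 0 <= t -> measurable_fun setT (L0 t)) /\
  exists (T : nat -> Omega -> R) (xi : nat -> Omega -> 'cV[R]_d),
  [/\ forall i, measurable_fun setT (T i) /\ measurable_fun setT (xi i),
      forall (k : nat) (U : nat -> set R) (E : nat -> set 'cV[R]_d),
        (forall i, measurable (U i)) -> (forall i, measurable (E i)) ->
        fine (P (\bigcap_(i < k) (T i @^-1` U i `&` xi i @^-1` E i))) =
        \prod_(i < k) (fine (P (T i @^-1` U i)) * fine (P (xi i @^-1` E i))),
      forall i (U : set R), measurable U ->
        P (T i @^-1` U) = exponential_prob (fine (nu0 setT)) U,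
      forall i (E : set 'cV[R]_d), measurable E ->
        P (xi i @^-1` E) = (nu0 E / nu0 setT)%E &
      {ae P, forall w, forall t (k : nat), 0 <= t ->
        \sum_(i < k) T i w <= t < \sum_(i < k.+1) T i w ->
        L0 t w = \sum_(i < k) xi i w}].

(* dX_t = A X_t dt + B dL_t, X_0 = x.  The noise is additive, so that the equation
   in integral form only contains the pathwise integral of A X_s. *)
Definition solves_OU n d (A : 'M[R]_n) (B : 'M[R]_(n, d))
    (L : R -> Omega -> 'cV[R]_d) (x : 'cV[R]_n) (X : R -> Omega -> 'cV[R]_n) :=
  (forall t, 0 <= t -> measurable_fun setT (X t)) /\
  {ae P, forall w, cadlag (X ^~ w) /\
    forall t, 0 <= t -> forall i,
      X t w i 0 = x i 0
        + \int[lebesgue_measure]_(s in `[0, t]) (A *m X s w) i 0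
        + (B *m L t w) i 0}.

Definition P1 n (X : 'cV[R]_n -> R -> Omega -> 'cV[R]_n) (tau : Omega -> \bar R)
    (t : R) (f : 'cV[R]_n -> R) (x : 'cV[R]_n) : \bar R :=
  (\int[P]_w (f (X x t w) * \1_[set w | (tau w <= t%:E)%E] w)%:E)%E.

End processes.

Section operator_norm_and_V.
Context (R : realType).
Local Open Scope ereal_scope.

Definition opnorm_Lp_Lq n (p q : \bar R)
    (S : ('cV[R]_n -> R) -> 'cV[R]_n -> \bar R) : \bar R :=
  ereal_sup [set Lnorm (lebesgue_cV R n) q (S f) | f in
    [set f | measurable_fun setT f /\
             Lnorm (lebesgue_cV R n) p (EFin \o f) <= 1]].

Definition V d (rho0 : 'cV[R]_d -> R) (lam0 p r : R) : \bar R :=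
  lam0^-1%:E *
  ereal_sup [set \int[lebesgue_cV R d]_z
                   (rho0 (z - z')%R `^ (p / (p - 1))
                    / rho0 z `^ (p - 1)^-1)%R%:E
            | z' in [set z' | (enorm z' <= r)%R]].

End operator_norm_and_V.

(* Main.v *)
Require Import Defs.
From HB Require Import structures.
From mathcomp Require Import all_boot all_order all_algebra.
From mathcomp Require Import all_classical all_reals all_analysis.
From mathcomp Require Import measurable_realfun ess_sup_inf.
From mathcomp Require Import ring lra.

(** The solution is [X_t^x = exp(tA) x + int_0^t exp((t-s)A) B dL_s], a linear
    functional of the noise. On the event that [L0] has jumped by time [t], its
    first jump [xi], at time [tau], contributes [exp((t-tau)A) B xi]. The jump [xi]
    is independent of [tau], of the later jumps and of [L1], and has the density
    [rho = rho0 / lam0]. Hence, with [W] the contribution of all the other noise,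

      [P1_t f(x) = E [1_{tau <= t} int f(exp(tA) x + W + exp((t-tau)A) B z) rho(z) dz]],

    which is lemma [representation].

    Two starting points [x] and [y] are compared by changing only this jump. Since
    [B] has a right inverse [B'], the shift [z' = B' exp(tau A) (x - y)] satisfies
    [exp((t-tau)A) B z' = exp(tA) (x - y)]: to start from [y] with the first jump
    [z + z'] amounts to starting from [x] with the first jump [z]. So [P1_t f(x)] is
    the same expectation as [P1_t f(y)], except that [rho(z)] is replaced by
    [rho(z - z')], where [|z'| <= c exp(|A|t) |x - y|] for [tau <= t]. Hoelder's
    inequality for [f rho^(1/p)] and [rho(. - z') / rho^(1/p)] on the product of the
    probability space and of the space of jumps gives the first inequality
    ([smear_harnack], [first_jump_harnack]): the second factor is bounded by [V] on
    the event, whose probability is [1 - exp(-lam0 t)].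

    For the operator norm, [y] is chosen with [exp(tA) y = exp(tA) x + v], and the
    inequality, divided by the power of [V], is integrated over [v]. Translation
    invariance of Lebesgue measure removes the random displacement, and leaves
    [(1 - exp(-lam0 t)) int f^p] on the right ([integral_smear],
    [smear_sup_bound]). The shift needed is now [- B' exp((tau-t)A) v], of norm at most
    [c exp(|A|t) |v|]. The integral of [V^(1-p)] is positive because [V] is finite,
    so the bound is finite.

    The stochastic part of the argument is pathwise. The equation
    [X = x + A int X + B L] is solved by its Neumann series, a limit of iterated
    integrals of the noise ([linear_equation_response]); this makes the solution a
    sum of measurable functions of [L1], of the first arrival and jump, and of the
    later arrivals and jumps ([noise_decomposition]), with no stochastic integral.
    Almost surely, the time of the first discontinuity of [L0] is the first
    exponential waiting time ([first_jump_timeE]). *)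

Set Implicit Arguments.
Unset Strict Implicit.
Unset Printing Implicit Defensive.

Import Order.TTheory GRing.Theory Num.Theory.
Import numFieldNormedType.Exports.

Local Open Scope classical_set_scope.
Local Open Scope ring_scope.

(** * Borel matrices and Lebesgue measure on column vectors *)

Section matrix_measurability.
Context (R : realType).
Context d (T : measurableType d).

Lemma measurable_mx_coord m n (i : 'I_m) (j : 'I_n) :
  measurable_fun setT (fun M : 'M[R]_(m, n) => M i j).
Proof.
move=> _ U mU; rewrite setTI; apply: sub_sigma_algebra.
by exists i, j, U.
Qed.

Lemma measurable_mxP m n (D : set T) (f : T -> 'M[R]_(m, n)) :
  measurable D ->
  (forall i j, measurable_fun D (fun x => f x i j)) -> measurable_fun D f.
Proof.
move=> mD mf; apply: (@measurability _ _ _ _ _ _ (@mx_cylinders R m n)) => //.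
by move=> _ [_ [i [j [U [mU ->]]]] <-]; exact: mf.
Qed.

Lemma measurable_mx_entry m n (D : set T) (f : T -> 'M[R]_(m, n)) i j :
  measurable_fun D f -> measurable_fun D (fun x => f x i j).
Proof.
by move=> mf; apply: (measurableT_comp (measurable_mx_coord i j)).
Qed.

Lemma measurable_mxD m n (D : set T) (f g : T -> 'M[R]_(m, n)) :
  measurable D -> measurable_fun D f -> measurable_fun D g ->
  measurable_fun D (fun x => f x + g x).
Proof.
move=> mD mf mg; apply: measurable_mxP => // i j.
under eq_fun do rewrite mxE.
by apply: measurable_funD; exact: measurable_mx_entry.
Qed.

Lemma measurable_mxZ m n (D : set T) (c : T -> R) (g : T -> 'M[R]_(m, n)) :
  measurable D -> measurable_fun D c -> measurable_fun D g ->
  measurable_fun D (fun x => c x *: g x).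
Proof.
move=> mD mf mg; apply: measurable_mxP => // i j.
under eq_fun do rewrite mxE.
by apply: measurable_funM => //; exact: measurable_mx_entry.
Qed.

Lemma measurable_mxM m n p (D : set T) (f : T -> 'M[R]_(m, n))
    (g : T -> 'M[R]_(n, p)) :
  measurable D -> measurable_fun D f -> measurable_fun D g ->
  measurable_fun D (fun x => f x *m g x).
Proof.
move=> mD mf mg; apply: measurable_mxP => // i j.
under eq_fun do rewrite mxE.
by apply: measurable_sum => k; apply: measurable_funM;
  exact: measurable_mx_entry.
Qed.

End matrix_measurability.

Section lebesgue.
Context (R : realType).

Lemma lebesgue_measure_shift (a : R) (A : set R) : measurable A ->
  lebesgue_measure ((fun x => x + a) @^-1` A) = lebesgue_measure A.
Proof.
move=> mA.
have mh : @measurable_fun _ _ (measurableTypeR R) (measurableTypeR R) setT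
    (fun x => x + a) by exact: measurable_funD.
pose mu' := measure_function_pushforward__canonical__measure_function_Measure
   (@lebesgue_measure R) mh.
rewrite -[LHS]/(mu' A); apply/esym/lebesgue_measure_unique => // _ [[b c]] _ <-.
rewrite -[RHS]/(lebesgue_measure ((fun x => x + a) @^-1` `]b, c]%classic)).
rewrite (_ : _ @^-1` _ = `]b - a, c - a]%classic); last first.
  by apply/seteqP; split => x /=; rewrite !in_itv /=; lra.
rewrite !lebesgue_measure_itv /= !lte_fin ltrBrDr subrK -!EFinD.
by case: ifP => // _; congr EFin; ring.
Qed.

Lemma lebesgue_cV_sigma_finite n : sigma_finite setT (lebesgue_cV R n).
Proof.
elim: n => [|n /sigma_finiteP[G [TG ndG Goo]]].
  exists (fun=> setT); first by rewrite bigcup_const//; exists 0%N.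
  by move=> k; split => //=; rewrite diracT ltry.
have /sigma_finiteP[F [TF ndF Foo]] := sigma_finiteT (@lebesgue_measure R).
have m1 : measurable_fun setT
    (fun v : 'cV[R]_n.+1 => v ord0 ord0 : measurableTypeR R).
  exact: measurable_mx_coord.
have m2 : measurable_fun setT
    (fun v : 'cV[R]_n.+1 => @dsubmx R 1 n 1 v).
  apply: measurable_mxP => // i j; under eq_fun do rewrite mxE.
  exact: measurable_mx_coord.
exists (fun k => ((fun v : 'cV[R]_n.+1 => v ord0 ord0) @^-1` F k)
     `&` ((@dsubmx R 1 n 1) @^-1` G k)).
  apply/esym/seteqP; split => // v _.
  have [k _ Fk] : (\bigcup_k F k) (v ord0 ord0) by rewrite -TF.
  have [l _ Gl] : (\bigcup_k G k) (@dsubmx R 1 n 1 v) by rewrite -TG.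
  exists (maxn k l) => //; split => /=.
    by move: Fk; exact/subsetPset/ndF/leq_maxl.
  by move: Gl; exact/subsetPset/ndG/leq_maxr.
move=> k; have [mF Fk] := Foo k; have [mG Gk] := Goo k; split.
  apply: measurableI.
    by rewrite -[X in measurable X]setTI; exact: m1.
  by rewrite -[X in measurable X]setTI; exact: m2.
rewrite /= /lebesgue_step /pushforward.
rewrite (_ : _ @^-1` _ = (F k `*` G k)); last first.
  have e a v : @consv R n (a, v) ord0 ord0 = a.
    rewrite /consv /= (_ : ord0 = lshift n (ord0 : 'I_1)); last exact/val_inj.
    by rewrite (col_mxEu (a%:M : 'M[R]_1) v) mxE.
  have e' a v : @dsubmx R 1 n 1 (@consv R n (a, v)) = v by exact: col_mxKd.
  by apply/seteqP; split => -[a v]; rewrite /= e e'.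
by rewrite product_measure2E// lte_mul_pinfty// ge0_fin_numE.
Qed.

(** A copy of [lebesgue_cV] as a plain set function: on it the sigma-finite
    structure can be found by unification. *)
Definition leb n : set 'cV[R]_n -> \bar R := lebesgue_cV R n.

HB.instance Definition _ n := Measure.on (@leb n).
HB.instance Definition _ n := Measure_isSigmaFinite.Build _ _ _ (@leb n)
  (@lebesgue_cV_sigma_finite n).

Lemma measurable_shift_cV n (v : 'cV[R]_n) :
  measurable_fun setT (fun z : 'cV[R]_n => z + v).
Proof. exact: measurable_mxD. Qed.

(** In the product defining the measure, the sections of a shifted set are
    shifted sections, for the first coordinate as for the others. *)
Lemma leb_shift n (v : 'cV[R]_n) (A : set 'cV[R]_n) : measurable A ->
  leb ((fun z => z + v) @^-1` A) = leb A.
Proof.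
rewrite /leb; elim: n => [|n IH] in v A *.
  move=> mA; congr (lebesgue_cV R 0 _).
  apply/funext => z /=; congr A.
  by rewrite (flatmx0 (z + v)) (flatmx0 z).
move=> mA; rewrite /= /lebesgue_step /pushforward.
pose w := @dsubmx R 1 n 1 v; pose a := v ord0 ord0.
pose B := @consv R n @^-1` A.
have mB : measurable B.
  by rewrite /B -[X in measurable X]setTI; exact: measurable_consv.
have mh := measurable_shift_cV w.
have shiftE (s : R) y : consv (s, y) + v = consv (s + a, y + w).
  rewrite /consv /= -{1}(vsubmxK (v : 'M[R]_(1 + n, 1))).
  rewrite [LHS](@add_col_mx R 1 n 1); congr (@col_mx R 1 n 1 _ _).
  apply/matrixP => i j; rewrite !ord1 !mxE !mulr1n; congr (_ + v _ _).
  exact/val_inj.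
transitivity (\int[lebesgue_cV R n]_y
   (fun u => lebesgue_measure (ysection B u)) (y + w)%R)%E.
  apply: eq_integral => y _ /=.
  have mys := measurable_ysection (y + w) mB.
  rewrite -(lebesgue_measure_shift a mys).
  congr lebesgue_measure; apply/funext => s.
  by apply/propext; rewrite /ysection /= !inE /B /= shiftE.
have mF : measurable_fun setT (fun u => lebesgue_measure (ysection B u)).
  exact: measurable_fun_ysection.
rewrite -(@ge0_integral_pushforward _ _ _ _ _ _ mh (lebesgue_cV R n) setT
   (fun u => lebesgue_measure (ysection B u)))//.
apply: eq_measure_integral => C mC _; exact: IH.
Qed.

Lemma ge0_integral_leb_shift n (v : 'cV[R]_n) (f : 'cV[R]_n -> \bar R) :
  measurable_fun setT f -> (forall x, 0 <= f x)%E ->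
  (\int[@leb n]_z f (z + v)%R = \int[@leb n]_z f z)%E.
Proof.
move=> mf f0.
have mh := measurable_shift_cV v.
have <- := @ge0_integral_pushforward _ _ _ _ _ _ mh (lebesgue_cV R n) setT f
   measurableT mf (fun y _ => f0 y).
by apply: eq_measure_integral => C mC _; exact: leb_shift.
Qed.

Lemma lebT_gt0 n : (0 < leb (setT : set 'cV[R]_n))%E.
Proof.
rewrite /leb; elim: n => [|n IH] /=; first by rewrite diracT.
rewrite /lebesgue_step /pushforward preimage_setT -setXTT product_measure2E//.
apply: mule_gt0 => //.
have -> : [set: measurableTypeR R] = `]-oo, +oo[%classic :> set R.
  by rewrite set_itvNyy.
by have := lebesgue_measure_itv `]-oo, +oo[%R => /= ->; exact: ltry.
Qed.

End lebesgue.

(** * The Euclidean norm and the matrix exponential *)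

Section euclidean.
Context (R : realType).

Lemma dotpC n (u v : 'cV[R]_n) : dotp u v = dotp v u.
Proof. by apply: eq_bigr => i _; rewrite mulrC. Qed.

Lemma dotpDl n (u v w : 'cV[R]_n) : dotp (u + v) w = dotp u w + dotp v w.
Proof. by rewrite -big_split; apply: eq_bigr => i _; rewrite mxE mulrDl. Qed.

Lemma dotpZl n a (u v : 'cV[R]_n) : dotp (a *: u) v = a * dotp u v.
Proof. by rewrite mulr_sumr; apply: eq_bigr => i _; rewrite mxE mulrA. Qed.

Lemma dotp_ge0 n (u : 'cV[R]_n) : 0 <= dotp u u.
Proof. by apply: sumr_ge0 => i _; rewrite -expr2 sqr_ge0. Qed.

Lemma sqr_enorm n (u : 'cV[R]_n) : enorm u ^+ 2 = dotp u u.
Proof. by rewrite sqr_sqrtr ?dotp_ge0. Qed.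

Lemma enorm_ge0 n (u : 'cV[R]_n) : 0 <= enorm u.
Proof. exact: sqrtr_ge0. Qed.

Lemma ler_entry_enorm n (u : 'cV[R]_n) i : `|u i 0| <= enorm u.
Proof.
rewrite -ler_sqr ?nnegrE ?enorm_ge0// sqr_enorm real_normK ?num_real//.
rewrite /dotp (bigD1 i)//= -expr2 lerDl.
by apply: sumr_ge0 => j _; rewrite -expr2 sqr_ge0.
Qed.

Lemma cauchy_schwarz n (u v : 'cV[R]_n) :
  dotp u v ^+ 2 <= dotp u u * dotp v v.
Proof.
have := dotp_ge0 v; rewrite le_eqVlt => /predU1P[v0|v0].
  have {}v0 i : v i 0 = 0.
    apply/eqP; rewrite -sqrf_eq0 eq_le sqr_ge0 andbT v0 /dotp.
    rewrite (bigD1 i)//= -expr2 lerDl.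
    by apply: sumr_ge0 => j _; rewrite -expr2 sqr_ge0.
  rewrite [X in X ^+ 2]big1 ?expr0n ?mulr_ge0 ?dotp_ge0// => i _.
  by rewrite v0 mulr0.
have := dotp_ge0 (dotp v v *: u + (- dotp u v) *: v).
rewrite dotpDl !dotpZl ![dotp _ (_ + _)]dotpC !dotpDl !dotpZl (dotpC v u).
set a := dotp u u; set b := dotp u v; set c := dotp v v => h.
have : 0 <= c * (a * c - b ^+ 2).
  by apply: le_trans h _; rewrite le_eqVlt; apply/orP; left; apply/eqP; ring.
by rewrite pmulr_rge0// subr_ge0.
Qed.

Lemma ler_enormD n (u v : 'cV[R]_n) : enorm (u + v) <= enorm u + enorm v.
Proof.
rewrite -ler_sqr ?nnegrE ?addr_ge0 ?enorm_ge0// sqr_enorm sqrrD !sqr_enorm.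
rewrite dotpDl !(dotpC _ (u + v)) !dotpDl (dotpC v u) -!addrA lerD2l !addrA.
rewrite lerD2r -!mulr2n ler_pMn2r//.
have := cauchy_schwarz u v; rewrite -!sqr_enorm -exprMn => h.
rewrite (le_trans (ler_norm _))// -ler_sqr ?nnegrE ?mulr_ge0 ?enorm_ge0//.
by rewrite real_normK ?num_real.
Qed.

Lemma enormZ n a (u : 'cV[R]_n) : enorm (a *: u) = `|a| * enorm u.
Proof.
rewrite /enorm dotpZl dotpC dotpZl mulrA -expr2 sqrtrM ?sqr_ge0//.
by rewrite sqrtr_sqr.
Qed.

Lemma enorm0 n : enorm (0 : 'cV[R]_n) = 0.
Proof. by rewrite -(scale0r 0) enormZ normr0 mul0r. Qed.

Lemma enorm_eq0 n (u : 'cV[R]_n) : enorm u = 0 -> u = 0.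
Proof.
move=> u0; apply/matrixP => i j; rewrite ord1 mxE; apply/eqP.
by rewrite -normr_le0 -u0 ler_entry_enorm.
Qed.

Lemma enormN n (u : 'cV[R]_n) : enorm (- u) = enorm u.
Proof. by rewrite -scaleN1r enormZ normrN normr1 mul1r. Qed.

Lemma ler_enorm_sum n (I : Type) (r : seq I) (F : I -> 'cV[R]_n) :
  enorm (\sum_(i <- r) F i) <= \sum_(i <- r) enorm (F i).
Proof.
elim/big_ind2 : _ => [|x a y b xa yb|//]; first by rewrite enorm0.
exact: le_trans (ler_enormD _ _) (lerD xa yb).
Qed.

Lemma mulmx_col_sum m n (A : 'M[R]_(m, n)) (v : 'cV[R]_n) :
  A *m v = \sum_j v j 0 *: col j A.
Proof.
apply/matrixP => i k; rewrite ord1 !mxE summxE; apply: eq_bigr => j _.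
by rewrite !mxE mulrC.
Qed.

Lemma opnorm_has_sup m n (A : 'M[R]_(m, n)) :
  has_sup [set enorm (A *m v) | v in [set v | enorm v <= 1]].
Proof.
split; first by exists (enorm (A *m 0)), 0 => //=; rewrite enorm0.
exists (\sum_j enorm (col j A)) => _ [v /= v1 <-].
rewrite mulmx_col_sum; apply: le_trans (ler_enorm_sum _ _) _.
apply: ler_sum => j _; rewrite enormZ ler_piMl ?enorm_ge0//.
exact: le_trans (ler_entry_enorm _ _) v1.
Qed.

Lemma opnorm_ge0 m n (A : 'M[R]_(m, n)) : 0 <= opnorm A.
Proof.
rewrite -(enorm0 m) -[X in enorm X](mulmx0 _ A).
apply: (ub_le_sup (opnorm_has_sup A).2).
by exists 0 => //=; rewrite enorm0.
Qed.

Lemma ler_opnorm m n (A : 'M[R]_(m, n)) (v : 'cV[R]_n) :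
  enorm (A *m v) <= opnorm A * enorm v.
Proof.
have [v0|v0] := eqVneq (enorm v) 0.
  by rewrite (enorm_eq0 v0) mulmx0 !enorm0 mulr0.
have vp : 0 < enorm v by rewrite lt0r v0 enorm_ge0.
rewrite -ler_pdivrMr// mulrC -[(enorm v)^-1]ger0_norm ?invr_ge0 ?enorm_ge0//.
rewrite -enormZ scalemxAr; apply: (ub_le_sup (opnorm_has_sup A).2).
exists ((enorm v)^-1 *: v) => //=.
by rewrite enormZ ger0_norm ?invr_ge0 ?enorm_ge0// mulVf.
Qed.

Lemma measurable_enorm n : measurable_fun setT (@enorm R n).
Proof.
apply: measurableT_comp; last first.
  apply: measurable_sum => i; apply: measurable_funM; exact: measurable_mx_coord.
have -> : Num.sqrt = (fun x : R => (Num.max x 0) `^ 2^-1).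
  apply/funext => x; case: (leP x 0) => x0.
    by rewrite powR0// ler0_sqrtr.
  by rewrite powR12_sqrt// ltW.
apply: (measurableT_comp (@measurable_powR R _)).
exact: measurable_maxr.
Qed.

Lemma ler_opnormX n (A : 'M[R]_n) k (v : 'cV[R]_n) :
  enorm (A ^+ k *m v) <= opnorm A ^+ k * enorm v.
Proof.
elim: k => [|k IH]; first by rewrite !expr0 [1%R]/(1%:M) mul1mx mul1r.
rewrite !exprS -[X in enorm (X *m v)]/(A *m (A ^+ k)) -mulmxA -mulrA.
apply: le_trans (ler_opnorm _ _) _; rewrite ler_wpM2l ?opnorm_ge0//.
Qed.

Lemma enorm_basis n (j : 'I_n) : enorm (delta_mx j 0 : 'cV[R]_n) = 1.
Proof.
rewrite /enorm /dotp (bigD1 j)//= big1 ?addr0.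
  by rewrite mxE !eqxx mulr1 sqrtr1.
by move=> i /negbTE ij; rewrite mxE ij mul0r.
Qed.

Lemma ler_entry_opnormX n (A : 'M[R]_n) k i j :
  `|(A ^+ k) i j| <= opnorm A ^+ k.
Proof.
have := ler_opnormX A k (delta_mx j 0); rewrite enorm_basis mulr1.
apply: le_trans; rewrite -colE; have := ler_entry_enorm (col j (A ^+ k)) i.
by rewrite mxE.
Qed.

End euclidean.

Section flow.
Context (R : realType) (n : nat) (A : 'M[R]_n).
Implicit Types (s r t : R).

Definition flow_coef i j k : R := (A ^+ k) i j / k`!%:R.

(** The matrix exponential [exp (s A)]. *)
Definition flow s : 'M[R]_n := \matrix_(i, j) limn (pseries (flow_coef i j) s).

Lemma is_cvg_flow i j s : cvgn (pseries (flow_coef i j) s).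
Proof.
apply: normed_cvg; rewrite /normed_series_of.
apply: (@series_le_cvg _ _ (exp_coeff (opnorm A * `|s|))) => [k|k|k|].
- exact: normr_ge0.
- by rewrite exp_coeff_ge0// mulr_ge0 ?opnorm_ge0.
- rewrite exp_coeffE /= /flow_coef !normrM normfV normrX exprMn.
  rewrite [`|k`!%:R|]ger0_norm// mulrAC [leRHS]mulrC ler_wpM2r ?invr_ge0//.
  by rewrite ler_wpM2r ?exprn_ge0// ler_entry_opnormX.
- exact: is_cvg_series_exp_coeff.
Qed.

Lemma flow_coef_diffs_l i j :
  pseries_diffs (flow_coef i j) = fun k => \sum_l A i l * flow_coef l j k.
Proof.
apply/funext => k; rewrite /pseries_diffs /flow_coef factS natrM invfM.
rewrite mulrCA (mulVKf (_ : k.+1%:R != 0)) ?pnatr_eq0// exprS [in LHS]mxE mulr_suml.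
by apply: eq_bigr => l _; rewrite mulrA.
Qed.

Lemma flow_coef_diffs_r i j :
  pseries_diffs (flow_coef i j) = fun k => \sum_l flow_coef i l k * A l j.
Proof.
apply/funext => k; rewrite /pseries_diffs /flow_coef factS natrM invfM.
rewrite mulrCA (mulVKf (_ : k.+1%:R != 0)) ?pnatr_eq0// exprSr [in LHS]mxE mulr_suml.
by apply: eq_bigr => l _; rewrite mulrAC.
Qed.

Lemma cvg_pseries_lin (I : finType) (c : I -> nat -> R) (a : I -> R) s :
  (forall l, cvgn (pseries (c l) s)) ->
  pseries (fun k => \sum_l a l * c l k) s @ \oo -->
    \sum_l a l * limn (pseries (c l) s).
Proof.
move=> cc.
have -> : pseries (fun k => \sum_l a l * c l k) s =
    fun K => \sum_l a l * pseries (c l) s K.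
  apply/funext => K; rewrite /pseries /series /=.
  under eq_bigr do rewrite mulr_suml.
  rewrite exchange_big; apply: eq_bigr => l _; rewrite mulr_sumr.
  by apply: eq_bigr => k _; rewrite mulrA.
apply: cvg_big => [|l _]; first exact: add_continuous.
by apply: cvgMl_tmp; exact: cc.
Qed.

Lemma is_derive_flow_l i j s :
  is_derive s 1 (fun r => flow r i j) ((A *m flow s) i j).
Proof.
have e k' l' r : limn (pseries (pseries_diffs (flow_coef k' l')) r) =
    (A *m flow r) k' l'.
  rewrite flow_coef_diffs_l mxE.
  under [RHS]eq_bigr do rewrite mxE.
  by apply: cvg_lim => //; apply: cvg_pseries_lin => l; exact: is_cvg_flow.
have -> : (fun r => flow r i j) = fun r => limn (pseries (flow_coef i j) r).
  by apply/funext => r; rewrite mxE.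
rewrite -e; apply: (@pseries_snd_diffs _ _ (`|s| + 1)).
- exact: is_cvg_flow.
- rewrite flow_coef_diffs_l; apply/cvg_ex; eexists.
  by apply: cvg_pseries_lin => l; exact: is_cvg_flow.
- rewrite flow_coef_diffs_l.
  have -> : pseries_diffs (fun k => \sum_l A i l * flow_coef l j k) =
      fun k => \sum_l A i l * pseries_diffs (flow_coef l j) k.
    apply/funext => k; rewrite /pseries_diffs mulr_sumr.
    by apply: eq_bigr => l _; rewrite mulrCA.
  apply/cvg_ex; eexists; apply: cvg_pseries_lin => l.
  rewrite flow_coef_diffs_l; apply/cvg_ex; eexists.
  by apply: cvg_pseries_lin => l'; exact: is_cvg_flow.
- by rewrite [ltRHS]ger0_norm ?addr_ge0// ltrDl.
Qed.

Lemma flow_comm s : A *m flow s = flow s *m A.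
Proof.
apply/matrixP => i j; rewrite !mxE.
transitivity (limn (pseries (pseries_diffs (flow_coef i j)) s)).
  rewrite flow_coef_diffs_l; under eq_bigr do rewrite mxE.
  apply/esym/cvg_lim => //; apply: cvg_pseries_lin => l; exact: is_cvg_flow.
rewrite flow_coef_diffs_r.
under [RHS]eq_bigr do rewrite mxE mulrC.
under [in LHS]eq_fun do under eq_bigr do rewrite mulrC.
by apply/cvg_lim => //; apply: cvg_pseries_lin => l; exact: is_cvg_flow.
Qed.

Lemma flow0 : flow 0 = 1%:M.
Proof.
apply/matrixP => i j; rewrite mxE; apply/cvg_lim => //.
rewrite -(cvg_shiftn 1); apply: cvg_near_cst; near=> K.
rewrite /= addn1 /pseries /series /= big_nat_recl// big1 ?addr0.
  by rewrite /flow_coef fact0 divr1 expr0 mulr1.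
by move=> k _; rewrite expr0n /= mulr0.
Unshelve. all: by end_near. Qed.

(** The product [flow (t - u) *m flow u] has zero derivative in [u], as
    [flow] commutes with [A]. *)
Lemma flowD s r : flow s *m flow r = flow (s + r).
Proof.
apply/matrixP => i k.
pose t := s + r.
pose F (u : R) : R := (flow (t - u) *m flow u) i k.
have F' (u : R) : is_derive u (1 : R) F 0.
  have -> : F = \sum_j ((fun u => flow (t - u) i j) * (fun u => flow u j k)).
    by apply/funext => v; rewrite fct_sumE /F mxE.
  have h1 j : is_derive u (1 : R) (fun u => flow (t - u) i j)
      (- (flow (t - u) *m A) i j).
    rewrite -flow_comm -mulN1r mulrC.
    apply: (@is_derive1_comp _ (fun v => flow v i j) (fun v => t - v)).
      exact: is_derive_flow_l.
    rewrite -[-1](sub0r 1).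
    exact: (is_deriveB (is_derive_cst t u (1 : R)) (is_derive_id u (1 : R))).
  apply: is_derive_eq.
    by apply: is_derive_sum => j; exact: is_deriveM (h1 j) (is_derive_flow_l j k u).
  rewrite big_split /= -[X in X + _]/(\sum_j flow (t - u) i j * (A *m flow u) j k).
  have e1 : \sum_j flow (t - u) i j * (A *m flow u) j k =
     (flow (t - u) *m A *m flow u) i k by rewrite -mulmxA [RHS]mxE.
  rewrite e1 [in X in X + _]mxE -big_split big1 // => j _ /=.
  by rewrite -[_ *: _]/(_ * _); ring.
have := is_derive_0_is_cst r 0 F'.
by rewrite /F subr0 flow0 mulmx1 /t addrK.
Qed.

Lemma measurable_flow : measurable_fun setT flow.
Proof.
apply: measurable_mxP => // i j.
apply: continuous_measurable_fun => s.
apply: differentiable_continuous; apply/derivable1_diffP.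
by have [] := is_derive_flow_l i j s.
Qed.

Lemma flow_series s (v : 'cV[R]_n) i :
  \sum_(k < K) (s ^+ k / k`!%:R) * (A ^+ k *m v) i 0 @[K --> \oo] -->
  (flow s *m v) i 0.
Proof.
have -> : (fun K => \sum_(k < K) (s ^+ k / k`!%:R) * (A ^+ k *m v) i 0) =
    pseries (fun k => \sum_l v l 0 * flow_coef i l k) s.
  apply/funext => K; rewrite /pseries /series /= big_mkord; apply: eq_bigr => k _.
  rewrite mxE mulr_sumr mulr_suml; apply: eq_bigr => l _; rewrite /flow_coef.
  by ring.
rewrite mxE; under eq_bigr do rewrite mulrC mxE.
by apply: cvg_pseries_lin => l; exact: is_cvg_flow.
Qed.

(** The partial sums of the series are dominated by those of the real
    exponential, and the square of the norm is continuous. *)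
Lemma ler_enorm_flow s (v : 'cV[R]_n) :
  enorm (flow s *m v) <= expR (opnorm A * `|s|) * enorm v.
Proof.
pose p K := \sum_(k < K) (s ^+ k / k`!%:R) *: (A ^+ k *m v).
have pl K : enorm (p K) <= expR (opnorm A * `|s|) * enorm v.
  apply: le_trans (ler_enorm_sum _ _) _.
  apply: le_trans (_ : series (exp_coeff (opnorm A * `|s|)) K * enorm v <= _).
    rewrite /series /= big_mkord mulr_suml; apply: ler_sum => k _.
    rewrite enormZ exp_coeffE normrM normfV normrX exprMn (ger0_norm (ler0n _ _)).
    rewrite mulrC [leRHS](_ : _ = (opnorm A ^+ k * enorm v) * (`|s| ^+ k / k`!%:R)).
      by rewrite ler_wpM2r ?ler_opnormX// divr_ge0 ?exprn_ge0.
    by rewrite /=; ring.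
  rewrite ler_wpM2r ?enorm_ge0//.
  have c := is_cvg_series_exp_coeff (opnorm A * `|s|).
  apply: nondecreasing_cvgn_le => //.
  apply: nondecreasing_series => k _; rewrite exp_coeff_ge0// mulr_ge0 ?opnorm_ge0//.
have pE K i : p K i 0 = \sum_(k < K) (s ^+ k / k`!%:R) * (A ^+ k *m v) i 0.
  by rewrite summxE; apply: eq_bigr => k _; rewrite mxE.
rewrite -ler_sqr ?nnegrE ?enorm_ge0 ?mulr_ge0 ?expR_ge0 ?enorm_ge0//.
have cv : enorm (p K) ^+ 2 @[K --> \oo] --> enorm (flow s *m v) ^+ 2.
  under eq_fun do rewrite sqr_enorm.
  rewrite sqr_enorm; apply: cvg_big => [|l _]; first exact: add_continuous.
  by apply: cvgM; under eq_fun do rewrite pE; exact: flow_series.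
rewrite -(cvg_lim _ cv)//; apply: limr_le; first by apply/cvg_ex; eexists; exact: cv.
by near=> K; rewrite ler_sqr ?nnegrE ?enorm_ge0 ?mulr_ge0 ?expR_ge0 ?enorm_ge0.
Unshelve. all: by end_near. Qed.

End flow.

(** * Right-continuous paths and their primitives *)

Section rlimsup.
Context (R : realType).

(** Where it exists, the limit; but also a measurable function of parameters at
    which the sequence diverges. *)
Definition rlimsup (u : nat -> R) : R := fine (limn_esup (EFin \o u)).

Lemma cvg_rlimsup (u : nat -> R) l : u @ \oo --> l -> rlimsup u = l.
Proof.
move=> ul; have ul' : EFin \o u @ \oo --> l%:E by apply: cvg_EFin => //; exact: nearW.
by rewrite /rlimsup is_cvg_limn_esupE; [rewrite (cvg_lim _ ul')|apply/cvg_ex; exists l%:E].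
Qed.

Lemma measurable_rlimsup d (T : measurableType d) (u : nat -> T -> R) :
  (forall k, measurable_fun setT (u k)) ->
  measurable_fun setT (fun x => rlimsup (u ^~ x)).
Proof.
move=> mu; apply: (measurableT_comp (@fine_measurable R setT measurableT)).
apply: (@measurable_fun_limn_esup _ _ _ setT (fun k x => (u k x)%:E)) => k.
exact/measurable_EFinP.
Qed.

End rlimsup.

Section regular_paths.
Context (R : realType).
Implicit Types (g h : R -> R) (s t T M : R).

(** Right continuity and local boundedness are what survives of the cadlag
    property under the operations below and suffices for integrals. *)
Definition rc_lb g :=
  (forall t, 0 <= t -> g s @[s --> t^'+] --> g t) /\
  (forall T, exists M, forall s, 0 <= s <= T -> `|g s| <= M).

(** The one-sided limits bound the path near each point, hence on segments by
    compactness. *)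
Lemma cadlag_rc_lb g :
  (forall t, 0 <= t -> g s @[s --> t^'+] --> g t) ->
  (forall t, 0 < t -> cvg (g s @[s --> t^'-])) -> rc_lb g.
Proof.
move=> rg lg; split=> // T.
have /compact_near_coveringP K := @segment_compact R 0 T.
have [|M [_ MT]] := K R (pinfty_nbhs R) (fun M x => 0 <= x <= T -> `|g x| <= M) _ _.
  move=> x /=; rewrite in_itv /= => /andP[x0 xT].
  have [l ll] : exists l, \forall y \near x^'-, 0 <= y -> `|g y| <= l.
    move: x0; rewrite le_eqVlt => /predU1P[<-|x0].
      exists 0; have := nbhs_left_lt (0 : R); apply: filterS => y y0.
      by rewrite leNgt y0.
    have /cvg_ex[l /cvgrPdist_le/(_ _ ltr01) ll] := lg _ x0.
    exists (`|l| + 1); apply: filterS ll => y ly _.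
    have -> : g y = l - (l - g y) by ring.
    by rewrite (le_trans (ler_normB _ _))// lerD2l.
  have rr : \forall y \near x^'+, `|g y| <= `|g x| + 1.
    have /cvgrPdist_le/(_ _ ltr01) := rg _ x0.
    apply: filterS => y ly.
    have -> : g y = g x - (g x - g y) by ring.
    by rewrite (le_trans (ler_normB _ _))// lerD2l.
  exists ([set y | 0 <= y -> `|g y| <= Num.max l (`|g x| + 1)],
      [set M | Num.max l (`|g x| + 1) <= M]) => /=.
    split.
      move: ll rr; rewrite !near_withinE => ll rr.
      apply: filterS (filterI ll rr) => y [ly ry] y0; rewrite le_max.
      have [yx|yx|->] := ltgtP y x.
      - by rewrite ly.
      - by rewrite ry// orbT.
      - by rewrite lerDl ler01 orbT.
    by apply: nbhs_pinfty_ge; exact: num_real.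
  by move=> [y M] /= [yM lM] /andP[y0 _]; exact: le_trans (yM y0) lM.
exists (M + 1) => s sT; apply: (MT (M + 1)) => //; first by rewrite ltrDl.
Qed.

Lemma rc_lb_cst a : rc_lb (fun=> a).
Proof. by split=> [t _|T]; [exact: cvg_cst|exists `|a|]. Qed.

Lemma rc_lbD g h : rc_lb g -> rc_lb h -> rc_lb (fun s => g s + h s).
Proof.
move=> [rg bg] [rh bh]; split=> [t t0|T]; first by apply: cvgD; auto.
have [M Mg] := bg T; have [N Nh] := bh T; exists (M + N) => s sT.
by rewrite (le_trans (ler_normD _ _))// lerD ?Mg ?Nh.
Qed.

Lemma rc_lbZ a g : rc_lb g -> rc_lb (fun s => a * g s).
Proof.
move=> [rg bg]; split=> [t t0|T]; first by apply: cvgMl_tmp; auto.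
by have [M Mg] := bg T; exists (`|a| * M) => s sT; rewrite normrM ler_wpM2l ?Mg.
Qed.

Lemma rc_lb_sum (I : Type) (r : seq I) (F : I -> R -> R) :
  (forall i, rc_lb (F i)) -> rc_lb (fun s => \sum_(i <- r) F i s).
Proof.
move=> rF; elim: r => [|i r IH].
  by under eq_fun do rewrite big_nil; exact: rc_lb_cst.
by under eq_fun do rewrite big_cons; exact: rc_lbD.
Qed.

(** Points of the grid of mesh [1 / m.+1], taken strictly to the right of [s], so
    that right continuity applies along them. *)
Definition grid m s : R := (Num.truncn (m.+1%:R * s)).+1%:R / m.+1%:R.

Lemma grid_gt m s : s < grid m s.
Proof. by rewrite /grid ltr_pdivlMr// mulrC truncnS_gt. Qed.

Lemma cvg_grid s : 0 <= s -> grid m s @[m --> \oo] --> s.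
Proof.
move=> s0; apply: (@squeeze_cvgr _ _ _ _ (fun=> s) (fun m => s + harmonic m)).
- near=> m; rewrite ltW ?grid_gt//= /grid /harmonic /= -natr1 mulrDl div1r.
  rewrite lerD2r ler_pdivrMr// mulrC truncn_le mulr_ge0//.
- exact: cvg_cst.
- rewrite -[X in _ --> X]addr0; apply: cvgD; [exact: cvg_cst|exact: cvg_harmonic].
Unshelve. all: by end_near. Qed.

Lemma rc_grid g s : 0 <= s -> g r @[r --> s^'+] --> g s ->
  g (grid m s) @[m --> \oo] --> g s.
Proof.
move=> s0 /cvg_at_rightP; apply; split; last exact: cvg_grid.
by move=> m; exact: grid_gt.
Qed.

Lemma measurable_truncn_eq (c : R) k :
  measurable [set s : R | Num.truncn (c * s) = k].
Proof.
rewrite (_ : [set s | _] = (fun s => c * s) @^-1`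
    (if k is 0%N then `]-oo, 1[ else `[k%:R, k.+1%:R[)%classic).
  by rewrite -[X in measurable X]setTI; apply: mulrl_measurable => //; case: k.
apply/seteqP; split => s /=.
  move=> <-; have [h|h] := leP 0 (c * s).
    move: (truncn_itv h); case: (Num.truncn _) => [|k'] /=; rewrite in_itv //=.
    by move=> /andP[].
  have -> : Num.truncn (c * s) = 0%N.
    by apply/eqP; rewrite -leqn0 truncn_le_nat (lt_trans h).
  by rewrite /= in_itv /= (lt_trans h).
case: k => [|k] /=; rewrite in_itv /=; last exact: truncn_def.
by move=> h; apply/eqP; rewrite -leqn0 truncn_le_nat.
Qed.

Lemma measurable_grid_process d (T : measurableType d) (Z : R -> T -> R) m :
  (forall s, 0 <= s -> measurable_fun setT (Z s)) ->
  measurable_fun [set: (measurableTypeR R * T)%type] (fun p => Z (grid m p.1) p.2).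
Proof.
move=> mZ _ U mU; rewrite setTI.
rewrite (_ : _ @^-1` _ = \bigcup_k
   ([set s : measurableTypeR R | Num.truncn (m.+1%:R * s) = k] `*`
    ([set: T] `&` (Z (k.+1%:R / m.+1%:R) @^-1` U)))).
  apply: bigcupT_measurable => k; apply: measurableX.
    exact: measurable_truncn_eq.
  by apply: mZ => //; rewrite divr_ge0.
apply/seteqP; split => [[s x] /= h|[s x] [k _ [/= sk [_]]]].
  by exists (Num.truncn (m.+1%:R * s)).
by rewrite /grid sk.
Qed.

(** A jointly measurable version of a process with right-continuous paths. *)
Definition jversion d (T : measurableType d) (Z : R -> T -> R)
  (p : measurableTypeR R * T) : R := rlimsup (fun m => Z (grid m p.1) p.2).

Lemma measurable_jversion d (T : measurableType d) (Z : R -> T -> R) :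
  (forall s, 0 <= s -> measurable_fun setT (Z s)) ->
  measurable_fun setT (jversion Z).
Proof.
move=> mZ; apply: (@measurable_rlimsup _ _ _ (fun m p => Z (grid m p.1) p.2)).
by move=> m; exact: measurable_grid_process.
Qed.

Lemma jversionE d (T : measurableType d) (Z : R -> T -> R) s x :
  rc_lb (Z ^~ x) -> 0 <= s -> jversion Z (s, x) = Z s x.
Proof.
by move=> [rZ _] s0; apply/cvg_rlimsup/(rc_grid (g := Z ^~ x)) => //; exact: rZ.
Qed.

Lemma rc_lb_measurable g t : rc_lb g ->
  measurable_fun `[0, t]%classic (g : measurableTypeR R -> measurableTypeR R).
Proof.
move=> rg; pose Z s (_ : unit) := g s.
apply: (@eq_measurable_fun _ _ _ _ _ (fun s => jversion Z (s, tt))).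
  move=> s; rewrite inE /= in_itv /= => /andP[s0 _].
  by rewrite (jversionE (Z := Z)).
apply: measurable_funTS.
apply: (measurableT_comp (@measurable_jversion _ _ Z _)).
  by move=> *; exact: measurable_cst.
exact: measurable_pair2.
Qed.

Notation mu := (@lebesgue_measure R).

Lemma rc_lb_integrable g t : rc_lb g -> mu.-integrable `[0, t] (EFin \o g).
Proof.
move=> rg; have [M Mg] := rg.2 t.
apply: (@measurable_bounded_integrable _ _ _ mu) => //.
- have /= -> := lebesgue_measure_itv `[0%R, t]%R; case: ifP => _ //.
  by rewrite -EFinB ltry.
- exact: rc_lb_measurable.
- exists M; split; first exact: num_real.
  move=> x Mx s /=; rewrite in_itv /= => /Mg /le_trans; apply; exact: ltW.
Qed.

Definition prim g t : R := \int[mu]_(s in `[0, t]) g s.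

Lemma primD g h t : rc_lb g -> rc_lb h ->
  prim (fun s => g s + h s) t = prim g t + prim h t.
Proof. by move=> rg rh; rewrite /prim RintegralD//; exact: rc_lb_integrable. Qed.

Lemma primZ a g t : rc_lb g -> prim (fun s => a * g s) t = a * prim g t.
Proof. by move=> rg; rewrite /prim RintegralZl//; exact: rc_lb_integrable. Qed.

Lemma eq_prim g h t : (forall s, 0 <= s <= t -> g s = h s) -> prim g t = prim h t.
Proof.
by move=> gh; apply: eq_Rintegral => s; rewrite inE /= in_itv /=; exact: gh.
Qed.

Lemma prim_sum (I : Type) (r : seq I) (F : I -> R -> R) t :
  (forall i, rc_lb (F i)) ->
  prim (fun s => \sum_(i <- r) F i s) t = \sum_(i <- r) prim (F i) t.
Proof.
move=> rF; elim: r => [|i r IH].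
  rewrite big_nil (eq_prim (h := fun=> 0 * 0)); last by move=> *; rewrite big_nil mulr0.
  by rewrite primZ ?mul0r//; exact: rc_lb_cst.
rewrite big_cons -IH -primD//; last exact: rc_lb_sum.
by apply: eq_prim => s _; rewrite big_cons.
Qed.

Lemma prim_le g h t : rc_lb g -> rc_lb h ->
  (forall s, 0 <= s <= t -> `|g s| <= h s) -> `|prim g t| <= prim h t.
Proof.
move=> rg rh gh; apply: le_trans (le_normr_Rintegral _ (rc_lb_integrable t rg)) _ => //.
apply: le_Rintegral => //.
- have := rc_lb_integrable t rg.
  by move/integrable_norm.
- exact: rc_lb_integrable.
Qed.

(** A primitive of a locally bounded function is locally Lipschitz. *)
Lemma rc_lb_prim g : rc_lb g -> rc_lb (prim g).
Proof.
move=> rg.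
have lip T : exists2 M, 0 < M & forall s r, 0 <= s -> s <= r -> r <= T ->
    `|prim g r - prim g s| <= M * (r - s).
  have [M Mg] := rg.2 T; exists (`|M| + 1) => [|s r s0 sr rT]; first by rewrite ltr_wpDl.
  rewrite /prim Rintegral_itvB ?bnd_simp//; last exact: rc_lb_integrable.
  have isub : mu.-integrable `]s, r] (EFin \o g).
    apply: integrableS (rc_lb_integrable r rg) => //.
    by apply: subset_itv; rewrite bnd_simp.
  apply: le_trans (le_normr_Rintegral _ isub) _ => //.
  have -> : (`|M| + 1) * (r - s) = \int[mu]_(x in `]s, r]) (`|M| + 1).
    rewrite Rintegral_cst//= lebesgue_measure_itv /= lte_fin.
    move: sr; rewrite le_eqVlt => /predU1P[->|->]; last by rewrite -EFinB.
    by rewrite ltxx subrr.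
  apply: le_Rintegral => //.
  - by move/integrable_norm : isub.
  - apply: (@measurable_bounded_integrable _ _ _ mu) => //.
    + have /= -> := lebesgue_measure_itv `]s, r]%R; case: ifP => _ //.
      by rewrite -EFinB ltry.
    + by exists (`|M| + 1); split=> // x Mx y _; rewrite ger0_norm ?addr_ge0// ltW.
  - move=> x /=; rewrite in_itv /= => /andP[sx xr].
    rewrite (le_trans (Mg _ _)) ?(le_trans s0 (ltW sx)) ?(le_trans xr)//.
    by rewrite (le_trans (ler_norm _))// lerDl.
have prim0 : prim g 0 = 0 by rewrite /prim set_itv1 Rintegral_set1.
split=> [t t0|T].
  have [M M0 Mg] := lip (t + 1).
  apply/cvgrPdist_le => e e0; near=> s.
  have ts : t <= s by near: s; exact: nbhs_right_ge.
  rewrite distrC (le_trans (Mg _ _ _ _ _))//.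
    by near: s; apply: nbhs_right_le; rewrite ltrDl.
  rewrite mulrC -ler_pdivlMr//; near: s.
  have := nbhs_right_ltDr t (divr_gt0 e0 M0).
  by apply: filterS => s; exact: ltW.
have [M M0 Mg] := lip T; exists (M * T) => s /andP[s0 sT].
have := Mg 0 s (lexx _) s0 sT; rewrite prim0 !subr0 => /le_trans; apply.
by rewrite ler_wpM2l// ltW.
Unshelve. all: by end_near. Qed.

(** The [k]-th iterated integral of a unit jump at time [S]. *)
Definition ramp S k s : R := if S <= s then (s - S) ^+ k / k`!%:R else 0.

Lemma rc_lb_ramp S k : rc_lb (ramp S k).
Proof.
split=> [t t0|T].
  have [St|tS] := leP S t.
    rewrite {2}/ramp St.
    apply: cvg_trans (_ : (fun s => (s - S) ^+ k / k`!%:R) @ t^'+ --> _).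
      apply: near_eq_cvg; near=> s; rewrite /ramp ifT// (le_trans St)//.
    apply: cvg_at_right_filter; apply: cvgMr_tmp.
    apply: (@continuous_comp _ _ _ (fun s => s - S) (fun s => s ^+ k)).
      apply: cvgB; [exact: cvg_id|exact: cvg_cst].
    exact: exprn_continuous.
  rewrite {2}/ramp leNgt tS /=.
  apply: cvg_near_cst; near=> s; rewrite /ramp leNgt ifN// negbK.
  by near: s; exact: nbhs_right_lt.
exists ((`|T| + `|S|) ^+ k / k`!%:R) => s /andP[s0 sT]; rewrite /ramp.
have p : 0 <= (`|T| + `|S|) ^+ k / k`!%:R by rewrite divr_ge0 ?exprn_ge0 ?addr_ge0.
case: ifP => Ss; last by rewrite normr0.
rewrite normrM normfV (ger0_norm (ler0n _ _)) ler_wpM2r ?invr_ge0// normrX.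
rewrite lerXn2r ?nnegrE ?addr_ge0// (le_trans (ler_normB _ _))// lerD2r.
by rewrite (ger0_norm s0) (le_trans sT)// ler_norm.
Unshelve. all: by end_near. Qed.

Lemma prim_ramp_le S k t : t <= S -> prim (ramp S k) t = 0.
Proof.
move=> tS; rewrite /prim -Rintegral_itv_bndo_bndc; last first.
  apply: integrableS (rc_lb_integrable t (rc_lb_ramp S k)) => //.
  by apply: subset_itvl; rewrite bnd_simp.
rewrite /Rintegral -[RHS]/(fine 0%E); congr fine; apply: integral0_eq => s /=.
rewrite in_itv /= => /andP[_ st]; rewrite /ramp ifF//.
by apply/negbTE; rewrite -ltNge (lt_le_trans st).
Qed.

Lemma prim_ramp S k t : 0 <= S -> 0 <= t -> prim (ramp S k) t = ramp S k.+1 t.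
Proof.
move=> S0 t0; have [St|tS] := ltP S t; last first.
  rewrite prim_ramp_le// /ramp; case: ifP => // tS'.
  have <- : S = t by apply/eqP; rewrite eq_le tS tS'.
  by rewrite subrr expr0n /= mul0r.
have rr := rc_lb_ramp S k.
rewrite -[LHS]subr0 -(prim_ramp_le k (lexx S)).
rewrite /prim Rintegral_itvB ?bnd_simp ?(ltW St)//; last exact: rc_lb_integrable.
rewrite Rintegral_itv_obnd_cbnd; last first.
  apply: integrableS (rc_lb_integrable t rr) => //.
  by apply: subset_itvr; rewrite bnd_simp.
pose f s := (s - S) ^+ k / k`!%:R.
pose F s := (s - S) ^+ k.+1 / k.+1`!%:R.
have dF s : is_derive s (1 : R) F (f s).
  have -> : F = (k.+1`!%:R)^-1 *: (((id : R -> R) - cst S) ^+ k.+1).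
    apply/funext => r; rewrite /F mulrC -[RHS]/(_ * _); congr (_ * _).
    by rewrite fctE.
  apply: is_derive_eq; rewrite subr0 /f factS natrM invfM !fctE /=.
  rewrite -[_ *: _]/(_ * _) -[_%:A]/(_ * 1) mulr1 mulrACA mulVf ?pnatr_eq0//.
  by rewrite mul1r mulrC.
have cF : continuous F.
  move=> s; apply: differentiable_continuous; apply/derivable1_diffP.
  by have [] := dF s.
have cf : continuous f.
  move=> s; apply: cvgMr_tmp.
  apply: (@continuous_comp _ _ _ (fun s => s - S) (fun s => s ^+ k)).
    by apply: cvgB; [exact: cvg_id|exact: cvg_cst].
  exact: exprn_continuous.
transitivity (\int[mu]_(s in `[S, t]) f s).
  apply: eq_Rintegral => s; rewrite inE /= in_itv /= => /andP[Ss _].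
  by rewrite /ramp Ss.
rewrite /Rintegral (@continuous_FTC2 _ f F)//.
- by rewrite -EFinB /= /F subrr expr0n /= mul0r subr0 /ramp (ltW St).
- exact: continuous_subspaceT.
- split.
  + by move=> s _; have [] := dF s.
  + exact/cvg_at_right_filter/cF.
  + exact/cvg_at_left_filter/cF.
- by move=> s _; rewrite derive1E; have [_ ->] := dF s.
Qed.

End regular_paths.

Section measurable_primitive.
Context (R : realType) d (T : measurableType d).
Notation mu := (@lebesgue_measure R).

Definition mprim (Z : R -> T -> R) t x : R :=
  fine (\int[mu]_(s in `[0%R, t]) (jversion Z (s, x))%:E)%E.

Lemma mprimE (Z : R -> T -> R) t x : rc_lb (Z ^~ x) ->
  mprim Z t x = prim (Z ^~ x) t.
Proof.
move=> rZ; congr fine; apply: eq_integral => s; rewrite inE /= in_itv /=.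
by move=> /andP[s0 _]; rewrite jversionE.
Qed.

Lemma measurable_mprim (Z : R -> T -> R) t :
  (forall s, 0 <= s -> measurable_fun setT (Z s)) ->
  measurable_fun setT (mprim Z t).
Proof.
move=> mZ; apply: (measurableT_comp (@fine_measurable R setT measurableT)).
pose D := [set p : measurableTypeR R * T | `[0%R, t]%classic p.1].
have mD : measurable D.
  by rewrite /D -[X in measurable X]setTI; apply: measurable_fst => //; exact: measurable_itv.
pose f := (EFin \o jversion Z) \_ D.
have mf : measurable_fun setT f.
  apply/(measurable_restrictT _ mD)/measurable_funTS/measurable_EFinP.
  exact: measurable_jversion.
have -> : (fun x => \int[mu]_(s in `[0%R, t]) (jversion Z (s, x))%:E)%E =
  (fun x => \int[mu]_s f^\+ (s, x) - \int[mu]_s f^\- (s, x))%E.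
  apply/funext => x; rewrite integral_mkcond integralE.
  have fE s : f (s, x) = ((EFin \o (fun s => jversion Z (s, x))) \_ `[0%R, t]) s.
    rewrite /f !patchE /D (_ : ((s, x) \in [set p | _]) = (s \in `[0%R, t]%classic))//.
  by congr (_ - _)%E; apply: eq_integral => s _; rewrite ?funeposE ?funenegE fE.
apply: emeasurable_funB.
- apply: (measurable_fun_fubini_tonelli_G (m1 := mu) (f^\+)%E) => //.
  exact: measurable_funepos.
- apply: (measurable_fun_fubini_tonelli_G (m1 := mu) (f^\-)%E) => //.
  exact: measurable_funeneg.
Qed.

End measurable_primitive.

(** * The linear integral equation *)

Section linear_response.
Context (R : realType) (n : nat).
Implicit Types (y z : R -> 'cV[R]_n) (A : 'M[R]_n) (s t : R).

Lemma eq_rc_lb (g h : R -> R) : (forall s, 0 <= s -> g s = h s) ->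
  rc_lb g -> rc_lb h.
Proof.
move=> gh [rg bg]; split=> [t t0|T].
  rewrite -gh//; apply: cvg_trans (rg t t0).
  apply: near_eq_cvg; near=> s; apply: gh; rewrite (le_trans t0)//.
have [M Mg] := bg T; exists M => s /andP[s0 sT].
by rewrite -gh// Mg// s0.
Unshelve. all: by end_near. Qed.

Definition regular m (y : R -> 'cV[R]_m) := forall i, rc_lb (fun s => y s i 0).

Definition vprim y t : 'cV[R]_n := \col_i prim (fun s => y s i 0) t.

Lemma regularD m (y z : R -> 'cV[R]_m) :
  regular y -> regular z -> regular (fun s => y s + z s).
Proof. by move=> ry rz i; under eq_fun do rewrite mxE; exact: rc_lbD. Qed.

Lemma regular_mulmx m k (A : 'M[R]_(m, k)) (y : R -> 'cV[R]_k) :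
  regular y -> regular (fun s => A *m y s).
Proof.
move=> ry i; under eq_fun do rewrite mxE.
by apply: rc_lb_sum => j; exact: rc_lbZ.
Qed.

Lemma regular_cst m (x : 'cV[R]_m) : regular (fun=> x).
Proof. by move=> i; exact: rc_lb_cst. Qed.

Lemma regular_vprim y : regular y -> regular (vprim y).
Proof.
by move=> ry i; under eq_fun do rewrite mxE; apply: rc_lb_prim.
Qed.

Lemma regular_iter y k : regular y -> regular (iter k vprim y).
Proof. by move=> ry; elim: k => //= k; exact: regular_vprim. Qed.

Lemma vprimD y z t : regular y -> regular z ->
  vprim (fun s => y s + z s) t = vprim y t + vprim z t.
Proof.
move=> ry rz; apply/matrixP => i j; rewrite !mxE -primD//.
by apply: eq_prim => s _; rewrite mxE.
Qed.

Lemma vprimM A y t : regular y -> vprim (fun s => A *m y s) t = A *m vprim y t.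
Proof.
move=> ry; apply/matrixP => i j; rewrite !mxE.
rewrite (@eq_prim _ _ (fun s => \sum_k A i k * y s k 0)); last first.
  by move=> s _; rewrite mxE.
rewrite prim_sum; last by move=> k; exact: rc_lbZ.
by apply: eq_bigr => k _; rewrite primZ// mxE.
Qed.

Lemma eq_vprim y z t : (forall s, 0 <= s <= t -> y s = z s) ->
  vprim y t = vprim z t.
Proof.
by move=> yz; apply/matrixP => i j; rewrite !mxE; apply: eq_prim => s /yz ->.
Qed.

Lemma eq_iter_vprim y z k t : (forall s, 0 <= s -> y s = z s) -> 0 <= t ->
  iter k vprim y t = iter k vprim z t.
Proof.
move=> yz; elim: k t => [|k IH] t t0 /=; first exact: yz.
by apply: eq_vprim => s /andP[s0 _]; exact: IH.
Qed.

Lemma iter_vprimD y z k t : regular y -> regular z -> 0 <= t ->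
  iter k vprim (fun s => y s + z s) t = iter k vprim y t + iter k vprim z t.
Proof.
move=> ry rz; elim: k t => [//|k IH] t t0 /=.
rewrite -vprimD; [|exact: regular_iter..].
by apply: eq_vprim => s /andP[s0 _]; exact: IH.
Qed.

Lemma iter_vprimM A y k t : regular y -> 0 <= t ->
  iter k vprim (fun s => A *m y s) t = A *m iter k vprim y t.
Proof.
move=> ry; elim: k t => [//|k IH] t t0 /=.
rewrite -vprimM; last exact: regular_iter.
by apply: eq_vprim => s /andP[s0 _]; exact: IH.
Qed.

Lemma iter_vprim_jump S (x : 'cV[R]_n) k t : 0 <= S -> 0 <= t ->
  iter k vprim (fun s => if S <= s then x else 0) t = ramp S k t *: x.
Proof.
move=> S0; elim: k t => [|k IH] t t0 /=.
  rewrite /ramp; case: ifP => _; last by rewrite scale0r.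
  by rewrite expr0 fact0 divr1 scale1r.
apply/matrixP => i j; rewrite !mxE ord1.
rewrite (@eq_prim _ _ (fun s => x i 0 * ramp S k s)).
  by rewrite primZ ?prim_ramp// 1?mulrC//; exact: rc_lb_ramp.
by move=> s /andP[s0 _]; rewrite IH// mxE mulrC.
Qed.

(** The [k]-th iterated integral of a bounded function is [O(s^k / k!)], which
    makes the Neumann series converge. *)
Lemma iter_vprim_bound y T : regular y -> exists2 M, 0 <= M &
  forall k i s, 0 <= s <= T -> `|iter k vprim y s i 0| <= M * (s ^+ k / k`!%:R).
Proof.
move=> ry; have /choice[M yM] : forall i, exists M, forall s, 0 <= s <= T ->
    `|y s i 0| <= M by move=> i; exact: (ry i).2.
have M0 : 0 <= \sum_i `|M i| by apply: sumr_ge0.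
exists (\sum_i `|M i|) => //; elim=> [|k IH] i s /andP[s0 sT].
  rewrite expr0 fact0 divr1 mulr1 /= (le_trans (yM i s _)) ?s0//.
  rewrite (le_trans (ler_norm _))// (bigD1 i)//= lerDl.
  exact: sumr_ge0.
rewrite /= mxE.
have rampE j (r : R) : 0 <= r -> ramp 0 j r = r ^+ j / j`!%:R.
  by move=> r0; rewrite /ramp r0 subr0.
rewrite -(rampE k.+1)// -prim_ramp// -primZ; last exact: rc_lb_ramp.
apply: prim_le.
- exact: regular_iter.
- exact/rc_lbZ/rc_lb_ramp.
- move=> r /andP[r0 rs]; rewrite rampE// IH// r0 /=.
  exact: le_trans sT.
Qed.

Definition neumann A y t K : 'cV[R]_n := \sum_(k < K) A ^+ k *m iter k vprim y t.

(** The solution at time [t] of [X = y + A int X], as a Neumann series. *)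
Definition response A y t : 'cV[R]_n :=
  \col_i rlimsup (fun K => neumann A y t K i 0).

Lemma neumann_term_bound A y t : regular y -> 0 <= t -> exists2 M, 0 <= M &
  forall k i, `|(A ^+ k *m iter k vprim y t) i 0| <=
    M * exp_coeff (opnorm A * t) k.
Proof.
move=> ry t0; have [M M0 yM] := iter_vprim_bound t ry.
exists (\sum_(j < n) M); first exact: sumr_ge0.
move=> k i; rewrite mxE (le_trans (ler_norm_sum _ _ _))// mulr_suml.
apply: ler_sum => j _; rewrite normrM exp_coeffE exprMn.
rewrite [leRHS](_ : _ = opnorm A ^+ k * (M * (t ^+ k / k`!%:R))).
  by rewrite ler_pM ?ler_entry_opnormX ?yM ?t0 /=.
by rewrite /=; ring.
Qed.

Lemma cvg_neumann A y t i : regular y -> 0 <= t ->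
  neumann A y t K i 0 @[K --> \oo] --> response A y t i 0.
Proof.
move=> ry t0; suff /cvg_ex[l cl] : cvgn (fun K => neumann A y t K i 0).
  by rewrite mxE (cvg_rlimsup cl).
have [M M0 yM] := neumann_term_bound A ry t0.
have -> : (fun K => neumann A y t K i 0) =
    series (fun k => (A ^+ k *m iter k vprim y t) i 0).
  by apply/funext => K; rewrite /series /= big_mkord summxE.
apply: normed_cvg; rewrite /normed_series_of.
apply: (@series_le_cvg _ _ (fun k => M * exp_coeff (opnorm A * t) k)) => [k|k|k|].
- exact: normr_ge0.
- by rewrite mulr_ge0// exp_coeff_ge0// mulr_ge0 ?opnorm_ge0.
- exact: yM.
- exact: (@is_cvg_seriesZ R _ M (is_cvg_series_exp_coeff (opnorm A * t))).
Qed.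

Lemma responseE A y t (x : 'cV[R]_n) :
  (forall i, neumann A y t K i 0 @[K --> \oo] --> x i 0) -> response A y t = x.
Proof.
move=> yx; apply/matrixP => i j; rewrite ord1 mxE.
by apply: cvg_rlimsup; exact: yx.
Qed.

Lemma eq_response A y z t : (forall s, 0 <= s -> y s = z s) -> 0 <= t ->
  response A y t = response A z t.
Proof.
move=> yz t0; apply/matrixP => i j; rewrite !mxE; congr rlimsup.
apply/funext => K; congr (fun_of_matrix _ _ _).
by apply: eq_bigr => k _; rewrite (eq_iter_vprim k yz).
Qed.

Lemma responseD A y z t : regular y -> regular z -> 0 <= t ->
  response A (fun s => y s + z s) t = response A y t + response A z t.
Proof.
move=> ry rz t0; apply: responseE => i; rewrite mxE.
have -> : (fun K => neumann A (fun s => y s + z s) t K i 0) =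
   (fun K => neumann A y t K i 0 + neumann A z t K i 0).
  apply/funext => K; rewrite !summxE -big_split; apply: eq_bigr => k _ /=.
  by rewrite iter_vprimD// mulmxDr mxE.
by apply: cvgD; exact: cvg_neumann.
Qed.

Lemma response_jump A S (x : 'cV[R]_n) t : 0 <= S -> 0 <= t ->
  response A (fun s => if S <= s then x else 0) t =
  if S <= t then flow A (t - S) *m x else 0.
Proof.
move=> S0 t0; apply: responseE => i.
have -> : (fun K => neumann A (fun s => if S <= s then x else 0) t K i 0) =
    fun K => \sum_(k < K) ramp S k t * (A ^+ k *m x) i 0.
  apply/funext => K; rewrite summxE; apply: eq_bigr => k _.
  by rewrite iter_vprim_jump// -scalemxAr mxE.
case: ifPn => [St|/negbTE St].
  under eq_fun do under eq_bigr do rewrite /ramp St.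
  exact: flow_series.
rewrite mxE; apply: cvg_near_cst; apply: nearW => K.
by rewrite big1// => k _; rewrite /ramp St mul0r.
Qed.

Lemma response_cst A (x : 'cV[R]_n) t : 0 <= t ->
  response A (fun=> x) t = flow A t *m x.
Proof.
move=> t0; have := @response_jump A 0 x t (lexx _) t0; rewrite t0 subr0 => <-.
by apply: eq_response => // s ->.
Qed.

(** Iterating the equation leaves a remainder [A^K int^K X], which tends to
    zero because the [K]-th iterated integral is [O(t^K / K!)]. *)
Lemma linear_equation_response A (X l : R -> 'cV[R]_n) t :
  regular X -> regular l -> 0 <= t ->
  (forall s, 0 <= s -> X s = l s + A *m vprim X s) -> X t = response A l t.
Proof.
move=> rX rl t0 eX.
have step K s : 0 <= s -> X s = neumann A l s K + A ^+ K *m iter K vprim X s.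
  move=> s0; elim: K => [|K IH].
    by rewrite /neumann big_ord0 add0r expr0 [1]/(1%:M) mul1mx.
  rewrite [LHS]IH /neumann big_ord_recr /= -addrA; congr (_ + _).
  rewrite -[vprim (iter _ _ _) _]/(iter K.+1 _ _ _) exprSr.
  rewrite -[A ^+ K * A]/(A ^+ K *m A) -mulmxA -mulmxDr; congr (_ *m _).
  have rvX := regular_vprim rX.
  rewrite iterSr -(iter_vprimM A K rvX s0).
  by rewrite -(iter_vprimD K rl (regular_mulmx A rvX) s0); exact: eq_iter_vprim.
apply/esym/responseE => i.
have [M M0 XM] := neumann_term_bound A rX t0.
have -> : (fun K => neumann A l t K i 0) =
    (fun K => X t i 0 - (A ^+ K *m iter K vprim X t) i 0).
  by apply/funext => K; rewrite [in RHS](step K t t0) mxE addrK.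
rewrite -[X in _ --> X]subr0; apply: cvgB; first exact: cvg_cst.
apply: norm_cvg0.
apply: (@squeeze_cvgr _ _ _ _ (fun=> 0) (fun K => M * exp_coeff (opnorm A * t) K)).
- by near=> K; rewrite normr_ge0 /= XM.
- exact: cvg_cst.
- by rewrite -[X in _ --> X](mulr0 M); apply: cvgMl_tmp; exact: cvg_exp_coeff.
Unshelve. all: by end_near. Qed.

(** The paths of a process are only almost surely regular, so [response] itself
    need not be measurable in the sample; it is replaced by a function built from
    jointly measurable versions, with the same values on regular paths. The
    sigma-algebra on [T] is arbitrary: it will be that of the driving process, so
    that independence is inherited. *)
Lemma measurable_response d (T : measurableType d) A (Z : R -> T -> 'cV[R]_n) t :
  (forall s, 0 <= s -> measurable_fun setT (Z s)) -> 0 <= t ->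
  exists2 Y : T -> 'cV[R]_n, measurable_fun setT Y &
    forall x, regular (Z ^~ x) -> Y x = response A (Z ^~ x) t.
Proof.
move=> mZ t0.
pose Zk := fix Zk k := if k is k'.+1 then
   (fun s x => \col_i mprim (fun r x => Zk k' r x i 0) s x) else Z.
have mZk k s : 0 <= s -> measurable_fun setT (Zk k s).
  elim: k s => [|k IH] s s0 /=; first exact: mZ.
  apply: measurable_mxP => // i j; under eq_fun do rewrite mxE.
  by apply: measurable_mprim => r r0; apply: measurable_mx_entry; exact: IH.
have ZkE k s x : regular (Z ^~ x) -> 0 <= s -> Zk k s x = iter k vprim (Z ^~ x) s.
  move=> rZ; elim: k s => [//|k IH] s s0.
  have rk i : rc_lb (fun r => Zk k r x i 0).
    by apply: eq_rc_lb (regular_iter k rZ i) => r r0; rewrite IH.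
  apply/matrixP => i j; rewrite /= !mxE mprimE//.
  by apply: eq_prim => r /andP[r0 _]; rewrite IH.
exists (fun x => \col_i rlimsup (fun K => (\sum_(k < K) A ^+ k *m Zk k t x) i 0)).
  apply: measurable_mxP => // i j; under eq_fun do rewrite mxE.
  apply: (@measurable_rlimsup _ _ _ (fun K x => (\sum_(k < K) A ^+ k *m Zk k t x) i 0)).
  move=> K; under eq_fun do rewrite summxE.
  apply: measurable_sum => k; apply: measurable_mx_entry.
  by apply: measurable_mxM => //; exact: mZk.
move=> x rZ; apply/matrixP => i j; rewrite !mxE; congr rlimsup.
by apply/funext => K; congr (fun_of_matrix _ _ _); apply: eq_bigr => k _; rewrite ZkE.
Qed.

End linear_response.

(** * Laws, independence and densities *)

Section integral_ae.
Context d (T : measurableType d) (R : realType).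
Variable mu : {measure set T -> \bar R}.
Local Open Scope ereal_scope.
Import HBNNSimple.

Let ge0_ae_le_integral (f g : T -> \bar R) :
  (forall x, 0 <= f x) -> (forall x, 0 <= g x) ->
  {ae mu, forall x, f x = g x} -> \int[mu]_x f x <= \int[mu]_x g x.
Proof.
move=> f0 g0 [N [mN N0 fgN]].
rewrite [leLHS]ge0_integralTE// [leRHS]ge0_integralTE//.
apply: ge_ereal_sup => _ [h /= hf <-].
have mNc : measurable (~` N) by exact: measurableC.
pose h' := mul_nnsfun h (indic_nnsfun R mNc).
have -> : sintegral mu h = sintegral mu h'.
  rewrite -2!integralT_nnsfun; apply: ge0_ae_eq_integral => //.
  - exact/measurable_EFinP.
  - exact/measurable_EFinP.
  - by move=> x _; rewrite lee_fin.
  - by move=> x _; rewrite lee_fin.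
  - exists N; split=> // x /= H; apply: contrapT => Nx; apply: H => _.
    by rewrite /h' /= /mindic indicE mem_set ?mulr1.
apply: ereal_sup_ubound; exists h' => //= x; rewrite /mindic indicE.
have [Nx|Nx] := boolP (x \in ~` N); last by rewrite mulr0.
rewrite mulr1; suff <- : f x = g x by [].
by apply: contrapT => fg; move: Nx; rewrite inE => Nx; apply: Nx; apply: fgN.
Qed.

(** The integral is defined without measurability conditions, as a difference
    of suprema over simple functions; these suprema ignore null sets. *)
Lemma eq_integral_ae (f g : T -> \bar R) :
  {ae mu, forall x, f x = g x} -> \int[mu]_x f x = \int[mu]_x g x.
Proof.
move=> fg; rewrite integralE [RHS]integralE; congr (_ - _).
- apply/eqP; rewrite eq_le; apply/andP; split; apply: ge0_ae_le_integral => //.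
  + by apply: filterS fg => x fgx; rewrite !funeposE fgx.
  + by apply: filterS fg => x fgx; rewrite !funeposE fgx.
- apply/eqP; rewrite eq_le; apply/andP; split; apply: ge0_ae_le_integral => //.
  + by apply: filterS fg => x fgx; rewrite !funenegE fgx.
  + by apply: filterS fg => x fgx; rewrite !funenegE fgx.
Qed.

End integral_ae.

Section law.
Context d1 d2 (Omega : measurableType d1) (T : measurableType d2) (R : realType).
Variables (P : probability Omega R) (Y : Omega -> T).
Hypothesis mY : measurable_fun setT Y.

(** The proof of measurability is an argument of [law], so that the structure of
    a probability can be attached to it. *)
Definition law of measurable_fun setT Y := pushforward P Y.

Let law0 : law mY set0 = 0%E.
Proof. by rewrite /law /pushforward preimage_set0 measure0. Qed.

Let law_ge0 A : (0 <= law mY A)%E.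
Proof. exact: measure_ge0. Qed.

Let law_sigma_additive : semi_sigma_additive (law mY).
Proof.
move=> F mF tF mUF; rewrite /law /pushforward preimage_bigcup.
apply: measure_semi_sigma_additive.
- by move=> k; rewrite -[X in measurable X]setTI; exact: mY.
- apply/trivIsetP => /= i j _ _ ij; rewrite -preimage_setI.
  by move/trivIsetP : tF => /(_ _ _ _ _ ij) ->//; rewrite preimage_set0.
- by rewrite -preimage_bigcup -[X in measurable X]setTI; exact: mY.
Qed.

HB.instance Definition _ := isMeasure.Build _ _ _ (law mY)
  law0 law_ge0 law_sigma_additive.

Let law_setT : law mY setT = 1%E.
Proof. by rewrite /law /pushforward preimage_setT probability_setT. Qed.

HB.instance Definition _ := Measure_isProbability.Build _ _ _ (law mY) law_setT.

Lemma ge0_integral_law (g : T -> \bar R) :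
  measurable_fun setT g -> (forall x, 0 <= g x)%E ->
  (\int[law mY]_y g y = \int[P]_w g (Y w))%E.
Proof.
move=> mg g0.
by have := @ge0_integral_pushforward _ _ _ _ _ _ mY P setT g measurableT mg
   (fun y _ => g0 y).
Qed.

End law.

Section independence.
Context d d1 d2 (Omega : measurableType d) (T1 : measurableType d1)
  (T2 : measurableType d2) (R : realType).
Variables (P : probability Omega R) (Y : Omega -> T1) (Z : Omega -> T2).
Hypotheses (mY : measurable_fun setT Y) (mZ : measurable_fun setT Z).
Hypothesis YZ : forall A B, measurable A -> measurable B ->
  P (Y @^-1` A `&` Z @^-1` B) = (P (Y @^-1` A) * P (Z @^-1` B))%E.

Lemma ge0_integral_independent (F : T1 * T2 -> \bar R) :
  measurable_fun setT F -> (forall x, 0 <= F x)%E ->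
  (\int[P]_w F (Y w, Z w) = \int[P]_w1 \int[P]_w2 F (Y w1, Z w2))%E.
Proof.
move=> mF F0.
have mYZ : measurable_fun setT (fun w => (Y w, Z w)) by exact: measurable_fun_pair.
rewrite -(ge0_integral_law P mYZ mF F0).
transitivity (\int[(law P mY \x law P mZ)%E]_x F x)%E.
  apply: eq_measure_integral => A mA _; apply/esym.
  by apply: product_measure_unique.
rewrite fubini_tonelli1// /fubini_F.
rewrite (ge0_integral_law P mY (g := fun y => \int[law P mZ]_z F (y, z))%E).
- apply: eq_integral => w _.
  rewrite (ge0_integral_law P mZ (g := fun z => F (Y w, z)))//.
  exact: measurableT_comp.
- exact: measurable_fun_fubini_tonelli_F.
- by move=> y; exact: integral_ge0.
Qed.

End independence.

Section density.
Context d d1 (Omega : measurableType d) (T : measurableType d1) (R : realType).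
Variables (P : probability Omega R) (mu : {measure set T -> \bar R}).
Variables (Z : Omega -> T) (r : T -> R).
Hypotheses (mZ : measurable_fun setT Z) (mr : measurable_fun setT r).
Hypothesis r0 : forall z, 0 <= r z.
Hypothesis rP : forall E, measurable E ->
  P (Z @^-1` E) = (\int[mu]_(z in E) (r z)%:E)%E.
Local Open Scope ereal_scope.
Import HBNNSimple.

(** The two integrals agree on simple functions by definition of the density,
    and then by monotone convergence. *)
Lemma ge0_integral_density (g : T -> \bar R) :
  measurable_fun setT g -> (forall z, 0 <= g z) ->
  \int[P]_w g (Z w) = \int[mu]_z (g z * (r z)%:E).
Proof.
move=> mg g0.
have mr' : measurable_fun setT (EFin \o r) by exact/measurable_EFinP.
have mind A : measurable A -> measurable_fun setT (fun w => \1_A (Z w) : R).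
  by move=> mA; exact: (measurableT_comp (@measurable_indic _ _ R setT A mA) mZ).
have indicE A (k : R) : measurable A -> (0 <= k)%R ->
    \int[P]_w (k * \1_A (Z w))%:E = \int[mu]_z ((k * \1_A z)%:E * (r z)%:E).
  move=> mA k0.
  transitivity (k%:E * P (Z @^-1` A)).
    under eq_integral do rewrite EFinM.
    rewrite ge0_integralZl_EFin//.
    - rewrite -[X in P X]setIT -integral_indic//.
      by rewrite -[X in measurable X]setTI; exact: mZ.
    - by apply/measurable_EFinP; exact: mind.
  rewrite rP// integral_mkcond -ge0_integralZl_EFin//.
  - apply: eq_integral => z _; rewrite patchE numfun.indicE.
    by case: ifPn => _; rewrite ?mulr1 ?mulr0 ?mule0 ?mul0e.
  - by move=> z _; rewrite patchE; case: ifPn => // _; rewrite lee_fin.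
  - exact/(measurable_restrictT _ mA)/measurable_funTS.
have sfE (h : {nnsfun T >-> R}) :
    \int[P]_w (h (Z w))%:E = \int[mu]_z ((h z)%:E * (r z)%:E).
  transitivity (\sum_(k \in range h) \int[P]_w (k * \1_(h @^-1` [set k]) (Z w))%:E).
    rewrite -ge0_integral_fsum//.
    - by apply: eq_integral => w _; rewrite fsumEFin// -fimfunE.
    - move=> k; apply/measurable_EFinP; apply: measurable_funM => //.
      exact: mind.
    - by move=> k w _; rewrite nnfun_muleindic_ge0.
  transitivity (\sum_(k \in range h)
      \int[mu]_z ((k * \1_(h @^-1` [set k]) z)%:E * (r z)%:E)).
    apply: eq_fsbigr => k; rewrite inE => -[z _ <-]; exact: indicE.
  rewrite -ge0_integral_fsum//.
  - apply: eq_integral => z _; rewrite [in RHS]fimfunE -fsumEFin//.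
    rewrite ge0_mule_fsuml// => k; exact: nnfun_muleindic_ge0.
  - move=> k; apply: emeasurable_funM => //; apply/measurable_EFinP.
    exact: measurable_funM.
  - by move=> k z _; apply: mule_ge0; [exact: nnfun_muleindic_ge0|rewrite lee_fin].
pose g_ := nnsfun_approx measurableT mg.
have cg z : (g_ n z)%:E @[n --> \oo] --> g z.
  by apply: cvg_nnsfun_approx.
transitivity (limn (fun n => \int[P]_w (g_ n (Z w))%:E)).
  rewrite -monotone_convergence//.
  - by apply: eq_integral => w _; apply/esym/cvg_lim => //; exact: cg.
  - by move=> n; apply/measurable_EFinP; exact: measurableT_comp.
  - by move=> n w _; rewrite lee_fin.
  - by move=> w _ m n mn; rewrite lee_fin; exact/lefP/nd_nnsfun_approx.
rewrite (_ : (fun n => _) = fun n => \int[mu]_z ((g_ n z)%:E * (r z)%:E)); last first.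
  by apply/funext => n; exact: sfE.
rewrite -monotone_convergence//.
- apply: eq_integral => z _; apply/cvg_lim => //.
  by apply: cvgeZr => //; exact: cg.
- by move=> n; apply: emeasurable_funM => //; exact/measurable_EFinP.
- by move=> n z _; rewrite mule_ge0// lee_fin.
- move=> z _ m n mn; rewrite lee_wpmul2r ?lee_fin//.
  exact/lefP/nd_nnsfun_approx.
Qed.

End density.

(** * Shifting a random vector that has a density *)

Section product_sigma_finite.
Context d1 d2 (T1 : measurableType d1) (T2 : measurableType d2) (R : realType).
Variable m1 : {sigma_finite_measure set T1 -> \bar R}.
Variable m2 : {sigma_finite_measure set T2 -> \bar R}.

(** A copy of the product measure, on which the sigma-finite structure can be
    found by unification. *)
Definition sf_product : set (T1 * T2) -> \bar R := (m1 \x m2)%E.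

HB.instance Definition _ := Measure.on sf_product.

Let sf_productT : sigma_finite setT sf_product.
Proof.
have /sigma_finiteP[F [TF ndF Foo]] := sigma_finiteT m1.
have /sigma_finiteP[G [TG ndG Goo]] := sigma_finiteT m2.
exists (fun k => F k `*` G k) => [|k].
  apply/esym/seteqP; split => // -[x y] _.
  have [i _ Fx] : (\bigcup_k F k) x by rewrite -TF.
  have [j _ Gy] : (\bigcup_k G k) y by rewrite -TG.
  exists (maxn i j) => //; split => /=.
    by move: x Fx; exact/subsetPset/ndF/leq_maxl.
  by move: y Gy; exact/subsetPset/ndG/leq_maxr.
have [mF Fk] := Foo k; have [mG Gk] := Goo k.
split; first exact: measurableX.
by rewrite /sf_product product_measure1E// lte_mul_pinfty// ge0_fin_numE.
Qed.

HB.instance Definition _ := Measure_isSigmaFinite.Build _ _ _ sf_product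
  sf_productT.

End product_sigma_finite.

Section harnack.
Context (R : realType) (n k : nat).
Context d (O : measurableType d) (Q : probability O R).
Variables (G : O -> 'M[R]_(n, k)) (W : O -> 'cV[R]_n) (J : set O).
Variable rho : 'cV[R]_k -> R.
Hypotheses (mG : measurable_fun setT G) (mW : measurable_fun setT W).
Hypotheses (mJ : measurable J) (mrho : measurable_fun setT rho).
Hypothesis rho_gt0 : forall z, 0 < rho z.

Local Notation M := (Q \x @leb R k)%E.

Definition landing (x : O * 'cV[R]_k) := W x.1 + G x.1 *m x.2.

Let mfst : measurable_fun [set: O * 'cV[R]_k] fst.
Proof. exact: measurable_fst. Qed.

Let msnd : measurable_fun [set: O * 'cV[R]_k] snd.
Proof. exact: measurable_snd. Qed.

Lemma measurable_landing : measurable_fun setT landing.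
Proof.
apply: measurable_mxD => //; first exact: measurableT_comp.
by apply: measurable_mxM => //; exact: measurableT_comp.
Qed.

Let mind : measurable_fun [set: O * 'cV[R]_k] (fun x => \1_J x.1 : R).
Proof. exact: (measurableT_comp (@measurable_indic _ _ R setT J mJ)). Qed.

Let mrho2 : measurable_fun [set: O * 'cV[R]_k] (fun x => rho x.2).
Proof. exact: measurableT_comp. Qed.

(** The expectation of [f (u + W + G z)] on the event [J], when [z] has density
    [rho] and is independent of the random parameters [W], [G] and [J]. *)
Definition smear (f : 'cV[R]_n -> R) (u : 'cV[R]_n) : \bar R :=
  (\int[M]_x (f (u + landing x) * \1_J x.1 * rho x.2)%:E)%E.

Lemma measurable_smear (f : 'cV[R]_n -> R) u : measurable_fun setT f ->
  measurable_fun setT (fun x => f (u + landing x) * \1_J x.1 * rho x.2).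
Proof.
move=> mf; apply: measurable_funM => //; apply: measurable_funM => //.
by apply: measurableT_comp => //; apply: measurable_mxD => //; exact: measurable_landing.
Qed.

(** The substitution of [z - z'] for [z] moves the difference of the starting
    points from the argument of [f] into the density. *)
Lemma smear_shift (f : 'cV[R]_n -> R) u u' (z' : O -> 'cV[R]_k) :
  measurable_fun setT f -> (forall x, 0 <= f x) -> measurable_fun setT z' ->
  (forall w, J w -> G w *m z' w = u - u') ->
  smear f u =
  (\int[M]_x (f (u' + landing x) * \1_J x.1 * rho (x.2 - z' x.1))%:E)%E.
Proof.
move=> mf f0 mz' Gz'.
have mz : measurable_fun setT (fun x : O * 'cV[R]_k => x.2 - z' x.1).
  apply: measurable_mxD => //.
  under eq_fun do rewrite -scaleN1r.
  by apply: measurable_mxZ => //; exact: measurableT_comp.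
have e1 := @fubini_tonelli1 _ _ _ _ _ Q (@leb R k)
  (fun x => (f (u + landing x) * \1_J x.1 * rho x.2)%:E).
rewrite /smear e1; last 2 first.
- by apply/measurable_EFinP; exact: measurable_smear.
- by move=> x; rewrite lee_fin !mulr_ge0// ltW.
have e2 := @fubini_tonelli1 _ _ _ _ _ Q (@leb R k)
  (fun x => (f (u' + landing x) * \1_J x.1 * rho (x.2 - z' x.1))%:E).
rewrite e2; last 2 first.
- apply/measurable_EFinP; apply: measurable_funM; last exact: measurableT_comp.
  apply: measurable_funM => //; apply: measurableT_comp => //.
  by apply: measurable_mxD => //; exact: measurable_landing.
- by move=> x; rewrite lee_fin !mulr_ge0// ltW.
apply: eq_integral => w _; rewrite /fubini_F /=.
have [Jw|Jw] := boolP (w \in J); last first.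
  by rewrite !integral0_eq// => z _; rewrite indicE (negbTE Jw) mulr0 mul0r.
have mF : measurable_fun setT (fun z => (f (u + landing (w, z)) * \1_J w * rho z)%:E).
  have := measurableT_comp (measurable_smear u mf) (measurable_pair1 w).
  by move=> /measurable_EFinP.
rewrite -(ge0_integral_leb_shift (- z' w) mF); last first.
  by move=> x; rewrite lee_fin !mulr_ge0// ltW.
apply: eq_integral => z _; congr ((f _ * _ * _)%:E).
rewrite /landing /= mulmxDr mulmxN Gz'; last by move: Jw; rewrite inE.
by apply/matrixP => i j; rewrite !mxE; ring.
Qed.

(** The density [rho (z - z') dz] is compared with [rho (z) dz] by Hoelder's
    inequality for [F = f rho^(1/p)] and [H = rho (. - z') / rho^(1/p)]. *)
Lemma smear_harnack (p : R) (f : 'cV[R]_n -> R) u u' (z' : O -> 'cV[R]_k)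
    (c : \bar R) :
  1 < p ->
  measurable_fun setT f -> (forall x, 0 <= f x) -> measurable_fun setT z' ->
  (forall w, J w -> G w *m z' w = u - u') ->
  (0 <= c)%E ->
  (forall w, J w -> (\int[leb (n := k)]_z
     (rho (z - z' w) `^ (p / (p - 1)) / rho z `^ (p - 1)^-1)%:E <= c)%E) ->
  (smear f u `^ p <= smear (fun x => f x `^ p)%R u' * (Q J * c) `^ (p - 1))%E.
Proof.
move=> p1 mf f0 mz' Gz' c0 cP.
have p0 : 0 < p by exact: lt_trans p1.
have p10 : 0 < p - 1 by rewrite subr_gt0.
pose q := p / (p - 1).
have q0 : 0 < q by rewrite divr_gt0.
have pq : p^-1 + q^-1 = 1.
  by rewrite /q invf_div; field; rewrite gt_eqF.
have mz : measurable_fun setT (fun x : O * 'cV[R]_k => x.2 - z' x.1).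
  apply: measurable_mxD => //.
  under eq_fun do rewrite -scaleN1r.
  by apply: measurable_mxZ => //; exact: measurableT_comp.
have mfS : measurable_fun setT (fun x : O * 'cV[R]_k => f (u' + landing x)).
  apply: measurableT_comp => //.
  by apply: measurable_mxD => //; exact: measurable_landing.
pose F x := f (u' + landing x) * \1_J x.1 * rho x.2 `^ p^-1.
pose H x := \1_J x.1 * (rho (x.2 - z' x.1) / rho x.2 `^ p^-1).
have mpow (s : R) : measurable_fun [set: O * 'cV[R]_k] (fun x => rho x.2 `^ s).
  exact: (measurableT_comp (@measurable_powR R s)).
have mF : measurable_fun setT F.
  by apply: measurable_funM => //; apply: measurable_funM.
have mH : measurable_fun setT H.
  apply: measurable_funM => //; apply: measurable_funM.
    exact: measurableT_comp.
  under eq_fun do rewrite -powRN.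
  exact: mpow.
have FH x : F x * H x = f (u' + landing x) * \1_J x.1 * rho (x.2 - z' x.1).
  rewrite /F /H; have r0 : rho x.2 `^ p^-1 != 0 by rewrite gt_eqF// powR_gt0.
  by rewrite indicE; case: (_ \in _) => /=; field.
have F0 x : 0 <= F x by rewrite !mulr_ge0 ?powR_ge0.
have H0 x : 0 <= H x by rewrite !mulr_ge0 ?invr_ge0 ?powR_ge0// ltW.
have e1 : smear f u = Lnorm M 1 (EFin \o (F \* H)%R).
  rewrite (smear_shift mf f0 mz' Gz') Lnorm1; apply: eq_integral => x _ /=.
  by rewrite -FH ger0_norm// mulr_ge0.
have := hoelder M mF mH p0 q0 pq; rewrite -e1 => hh.
have sm0 : (0 <= smear f u)%E.
  by apply: integral_ge0 => x _; rewrite lee_fin !mulr_ge0// ltW.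
have := @gt0_ler_poweR _ p (ltW p0) _ _ _ _ hh.
rewrite !in_itv /= !leey !andbT => /(_ sm0).
rewrite mule_ge0 ?Lnorm_ge0// => /(_ isT) /le_trans; apply.
rewrite poweRM ?Lnorm_ge0// poweR_Lnorm ?gt_eqF//.
have -> : (\int[M]_x `|(EFin \o F) x| `^ p = smear (fun x => f x `^ p)%R u')%E.
  apply: eq_integral => x _; rewrite [X in (X `^ p)%E]/= ger0_norm// poweR_EFin.
  congr EFin.
  rewrite /F powRM ?mulr_ge0 ?powR_ge0// powRM// -powRrM mulVf ?gt_eqF//.
  rewrite powRr1 ?ltW//; congr (_ * _ * _).
  by rewrite indicE; case: (_ \in _); rewrite ?powR1// powR0// gt_eqF.
apply: lee_pmul => //.
- by apply: integral_ge0 => x _; rewrite lee_fin !mulr_ge0 ?powR_ge0// ltW.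
- exact: poweR_ge0.
have pE : p = q * (p - 1) by rewrite /q -mulrA mulVf ?mulr1// gt_eqF.
rewrite [in leLHS]pE poweRrM poweR_Lnorm ?gt_eqF//.
have HqE x : (`|(EFin \o H) x| `^ q = (\1_J x.1 *
    (rho (x.2 - z' x.1) `^ (p / (p - 1)) / rho x.2 `^ (p - 1)^-1))%:E)%E.
  rewrite /= ger0_norm//; congr EFin.
  rewrite /H powRM//; last by rewrite divr_ge0 ?powR_ge0// ltW.
  rewrite [X in X * _](_ : _ = \1_J x.1); last first.
    by rewrite indicE; case: (_ \in _); rewrite ?powR1// powR0// gt_eqF.
  congr (_ * _).
  rewrite powRM ?invr_ge0 ?powR_ge0 ?ltW// -/q; congr (_ * _).
  rewrite -powRN -powRrM mulNr powRN; congr (_ `^ _)^-1.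
  by rewrite /q; field; rewrite !gt_eqF.
under eq_integral do rewrite HqE.
apply: gt0_ler_poweR; rewrite ?in_itv /= ?leey ?andbT; first exact: ltW.
- apply: integral_ge0 => x _.
  by rewrite lee_fin !mulr_ge0 ?invr_ge0 ?powR_ge0.
- by rewrite mule_ge0.
have mHq : measurable_fun setT (fun x : O * 'cV[R]_k => (\1_J x.1 *
    (rho (x.2 - z' x.1) `^ (p / (p - 1)) / rho x.2 `^ (p - 1)^-1))%:E).
  apply/measurable_EFinP; apply: measurable_funM => //; apply: measurable_funM.
    apply: (measurableT_comp (@measurable_powR R _)); exact: measurableT_comp.
  under eq_fun do rewrite -powRN.
  exact: mpow.
rewrite fubini_tonelli1//; last first.
  by move=> x; rewrite lee_fin !mulr_ge0 ?invr_ge0 ?powR_ge0.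
rewrite /fubini_F /=.
have -> : (Q J * c = \int[Q]_w (c * (\1_J w)%:E))%E.
  have mi : measurable_fun setT (fun w => (\1_J w : R)%:E).
    exact/measurable_EFinP/measurable_indic.
  have -> : (\int[Q]_w (c * (\1_J w)%:E) = c * \int[Q]_w (\1_J w)%:E)%E.
    by apply: ge0_integralZl => // w _; rewrite lee_fin.
  by rewrite integral_indic// setIT muleC.
apply: ge0_le_integral => //.
- by move=> w _; apply: integral_ge0 => z _;
    rewrite lee_fin !mulr_ge0 ?invr_ge0 ?powR_ge0.
- apply: (@measurable_fun_fubini_tonelli_F _ _ _ _ R (@leb R k) _ mHq) => x.
  by rewrite lee_fin !mulr_ge0 ?invr_ge0 ?powR_ge0.
- apply: emeasurable_funM => //; exact/measurable_EFinP/measurable_indic.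
- move=> w _; rewrite indicE; have [Jw|Jw] := boolP (w \in J).
    rewrite mule1; under eq_integral do rewrite mul1r.
    by apply: cP; move: Jw; rewrite inE.
  by rewrite mule0 integral0_eq// => z _; rewrite mul0r.
Qed.

Lemma measurable_smear_joint (f : 'cV[R]_n -> R) u : measurable_fun setT f ->
  measurable_fun setT (fun y : 'cV[R]_n * (O * 'cV[R]_k) =>
    f (u + y.1 + landing y.2) * \1_J y.2.1 * rho y.2.2).
Proof.
move=> mf.
have m2 : measurable_fun setT (snd : 'cV[R]_n * (O * 'cV[R]_k) -> _).
  exact: measurable_snd.
apply: measurable_funM; last exact: (measurableT_comp mrho2 m2).
apply: measurable_funM; last exact: (measurableT_comp mind m2).
apply: measurableT_comp => //; apply: measurable_mxD => //.
  by apply: measurable_mxD => //; exact: measurable_fst.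
exact: (measurableT_comp measurable_landing m2).
Qed.

Lemma measurable_smear_start (f : 'cV[R]_n -> R) u :
  measurable_fun setT f -> (forall x, 0 <= f x) ->
  measurable_fun setT (fun v : 'cV[R]_n => smear f (u + v)).
Proof.
move=> mf f0; have /measurable_EFinP mh := measurable_smear_joint u mf.
apply: (@measurable_fun_fubini_tonelli_F _ _ _ _ R (sf_product Q (@leb R k)) _ mh).
by move=> y; rewrite lee_fin !mulr_ge0// ltW.
Qed.

(** Averaging the starting point over Lebesgue measure forgets the random
    displacement. *)
Lemma integral_smear (f : 'cV[R]_n -> R) u :
  measurable_fun setT f -> (forall x, 0 <= f x) ->
  (\int[leb (n := k)]_z (rho z)%:E = 1)%E ->
  (\int[leb (n := n)]_v smear f (u + v)%R =
     Q J * \int[leb (n := n)]_v (f v)%:E)%E.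
Proof.
move=> mf f0 rho1.
have If0 : (0 <= \int[leb (n := n)]_v (f v)%:E)%E.
  by apply: integral_ge0 => v _; rewrite lee_fin.
pose h (y : 'cV[R]_n * (O * 'cV[R]_k)) : R :=
  f (u + y.1 + landing y.2) * \1_J y.2.1 * rho y.2.2.
have mh : measurable_fun setT h by exact: measurable_smear_joint.
have h0 y : 0 <= h y by rewrite !mulr_ge0// ltW.
transitivity (\int[M]_x \int[leb (n := n)]_v (h (v, x))%:E)%E.
  have mh' : measurable_fun setT (EFin \o h) by exact/measurable_EFinP.
  by rewrite -(@fubini_tonelli _ _ _ _ R (leb (n := n)) (sf_product Q (@leb R k)) (EFin \o h) mh').
have step x : (\int[leb (n := n)]_v (h (v, x))%:E =
    (\1_J x.1 * rho x.2)%:E * \int[leb (n := n)]_v (f v)%:E)%E.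
  transitivity (\int[leb (n := n)]_v
      ((\1_J x.1 * rho x.2)%:E * (f (v + (u + landing x))%R)%:E))%E.
    apply: eq_integral => v _; rewrite -EFinM; congr EFin.
    have -> : v + (u + landing x) = u + v + landing x by rewrite addrCA addrA.
    by rewrite /h /=; ring.
  have mfs : measurable_fun setT (fun v : 'cV[R]_n => (f (v + (u + landing x)))%:E).
    apply/measurable_EFinP; apply: measurableT_comp => //.
    exact: measurable_shift_cV.
  rewrite ge0_integralZl_EFin//; last 2 first.
  - by move=> v _; rewrite lee_fin.
  - by rewrite mulr_ge0// ltW.
  rewrite (ge0_integral_leb_shift (u + landing x) (f := fun v => (f v)%:E))//.
    exact/measurable_EFinP.
under eq_integral do rewrite step.
have mk : measurable_fun setT (fun x : O * 'cV[R]_k => (\1_J x.1 * rho x.2)%:E).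
  by apply/measurable_EFinP; apply: measurable_funM.
have k0 (x : O * 'cV[R]_k) : (0 <= (\1_J x.1 * rho x.2)%:E)%E.
  by rewrite lee_fin mulr_ge0// ltW.
rewrite ge0_integralZr//; congr (_ * _)%E.
rewrite fubini_tonelli1// /fubini_F /=.
transitivity (\int[Q]_w (\1_J w : R)%:E)%E; last by rewrite integral_indic// setIT.
apply: eq_integral => w _.
under eq_integral do rewrite EFinM.
rewrite ge0_integralZl_EFin//; first by rewrite rho1 mule1.
- by move=> z _; rewrite lee_fin ltW.
- exact/measurable_EFinP.
Qed.

End harnack.

(** * Arrival times of a compound Poisson process *)

Section arrival_times.
Context dO (Omega : measurableType dO) (R : realType) (P : probability Omega R).
Context (k : nat) (lam : R) (T : nat -> Omega -> R) (xi : nat -> Omega -> 'cV[R]_k).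
Hypothesis lam0 : 0 < lam.
Hypothesis mT : forall i, measurable_fun setT (T i).
Hypothesis mxi : forall i, measurable_fun setT (xi i).
Hypothesis Txi : forall (K : nat) (U : nat -> set R) (E : nat -> set 'cV[R]_k),
  (forall i, measurable (U i)) -> (forall i, measurable (E i)) ->
  fine (P (\bigcap_(i < K) (T i @^-1` U i `&` xi i @^-1` E i))) =
  \prod_(i < K) (fine (P (T i @^-1` U i)) * fine (P (xi i @^-1` E i))).
Hypothesis expT : forall i (U : set R), measurable U ->
  P (T i @^-1` U) = exponential_prob lam U.

Definition arrival j w : R := \sum_(i < j) T i w.

Let mpre i (U : set R) : measurable U -> measurable (T i @^-1` U).
Proof. by move=> mU; rewrite -[X in measurable X]setTI; exact: mT. Qed.

Let mprex i (E : set 'cV[R]_k) : measurable E -> measurable (xi i @^-1` E).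
Proof. by move=> mU; rewrite -[X in measurable X]setTI; exact: mxi. Qed.

Lemma wait_gt0 : {ae P, forall w, forall i, 0 < T i w}.
Proof.
apply: ae_foralln => i; exists (T i @^-1` `]-oo, 0]%classic); split.
- by apply: mpre; exact: measurable_itv.
- transitivity (exponential_prob lam `]-oo, 0]%classic).
    by apply: expT; exact: measurable_itv.
  rewrite /exponential_prob -integral_itv_bndo_bndc.
    apply: integral0_eq => x /=; rewrite in_itv /= => x0.
    by rewrite lt0_exponential_pdf.
  by apply/measurable_EFinP/measurable_funTS; exact: measurable_exponential_pdf.
- by move=> w /= /negP; rewrite -leNgt in_itv.
Qed.

Lemma prob_wait i t : 0 < t ->
  P (T i @^-1` `[0, t]%classic) = (1 - expR (- (lam * t)))%:E.
Proof.
by move=> t0; rewrite expT ?measurable_itv// exponential_prob_itv0c// mulNr.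
Qed.

(** Infinitely many waiting times exceed [1], so that arrivals do not accumulate. *)
Lemma arrival_unbounded : {ae P, forall w, forall t, exists j, t < arrival j w}.
Proof.
pose c := 1 - expR (- (lam * 1)) : R.
have c1 : 0 <= c < 1.
  rewrite /c subr_ge0 gtrBl expR_gt0 andbT -[leRHS]expR0 ler_expR oppr_le0.
  by rewrite mulr1 ltW.
pose I := `[0, 1]%classic : set R.
have PI i : fine (P (T i @^-1` I)) = c.
  by rewrite /I prob_wait.
have small m : P (\bigcap_(i in [set i | (m <= i)%N]) (T i @^-1` I)) = 0%E.
  have mcap : measurable (\bigcap_(i in [set i | (m <= i)%N]) (T i @^-1` I)).
    by apply: bigcap_measurable => [|i _]; [by exists m => /=|apply: mpre; exact: measurable_itv].
  apply/eqP; rewrite eq_le measure_ge0 andbT.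
  apply/lee_addgt0Pr => e e0; rewrite add0e.
  have [N _ /(_ N.+1 (leqnSn N)) Ne] : \forall N \near \oo, c ^+ N < e.
    have : (fun N => c ^+ N) @ \oo --> 0.
      by apply: cvg_expr; rewrite ger0_norm; case/andP: c1.
    move/cvgrPdist_lt => /(_ e e0); apply: filterS => N.
    rewrite sub0r normrN; apply: le_lt_trans; exact: ler_norm.
  pose U i : set R := if (m <= i)%N then I else setT.
  have mU i : measurable (U i) by rewrite /U; case: ifP => _ //; exact: measurable_itv.
  have := Txi (m + N.+1)%N mU (fun _ => measurableT : measurable [set: 'cV[R]_k]).
  under [X in _ = X -> _]eq_bigr do rewrite preimage_setT probability_setT /= mulr1.
  have -> : \prod_(i < m + N.+1) fine (P (T i @^-1` U i)) = c ^+ N.+1.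
    rewrite big_split_ord /= big1 ?mul1r.
      rewrite -[X in _ ^+ X](card_ord N.+1) -prodr_const; apply: eq_bigr => i _.
      by rewrite /U /= leq_addr PI.
    by move=> i _; rewrite /U leqNgt ltn_ord /= preimage_setT probability_setT.
  set C := \bigcap_(i < m + N.+1) _ => PC.
  have mC : measurable C.
    apply: bigcap_measurable => [|i _]; first by exists 0%N; rewrite /= addnS.
    by apply: measurableI; [exact: mpre|exact: mprex].
  apply: (@le_trans _ _ (P C)).
    apply: le_measure; rewrite ?inE//.
    move=> w /= Iw i iN; split => //.
    by rewrite /U; case: ifP => mi //; exact: Iw.
  by rewrite -[P C]fineK ?fin_num_measure// PC lee_fin ltW.
have big : {ae P, forall w, forall m, exists2 i, (m <= i)%N & ~ I (T i w)}.
  apply: ae_foralln => m.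
  exists (\bigcap_(i in [set i | (m <= i)%N]) (T i @^-1` I)); split => //.
    by apply: bigcap_measurable => [|i _]; [by exists m => /=|apply: mpre; exact: measurable_itv].
    exact: small.
  by move=> w /= h i mi; apply: contrapT => nI; apply: h; exists i.
apply: filterS2 wait_gt0 big => w Tp big t.
suff [N tN] : exists N : nat, t < N%:R.
  suff [j] : exists j, N%:R <= arrival j w by exists j; exact: lt_le_trans tN _.
  elim: N {tN} => [|N [j jN]]; first by exists 0%N; rewrite /arrival big_ord0.
  have [i ji Ti] := big j; exists i.+1; rewrite /arrival big_ord_recr /= -natr1.
  apply: lerD.
    apply: le_trans jN _; rewrite /arrival -(subnKC ji) big_split_ord /= lerDl.
    by apply: sumr_ge0 => l _; exact: ltW.
  move: Ti; rewrite /I /= in_itv /= (ltW (Tp i)) /=; move/negP; rewrite -ltNge.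
  exact: ltW.
exists (Num.truncn t).+1; exact: truncnS_gt.
Qed.

(** Generators of the sigma-algebra of everything but the first jump size: the
    condition on [E 0] withholds it. *)
Definition other_events : set_system Omega :=
  [set C | exists K (U : nat -> set R) (E : nat -> set 'cV[R]_k),
    [/\ forall i, measurable (U i), forall i, measurable (E i), E 0%N = setT &
      C = \bigcap_(i < K) (T i @^-1` U i `&` xi i @^-1` E i)]].

Lemma other_events_measurable C : other_events C -> measurable C.
Proof.
move=> [[|K] [U [E [mU mE _ ->]]]].
  by rewrite (_ : \bigcap_(i < 0) _ = setT)//; apply/seteqP; split => // w _ i.
by apply: bigcap_measurable => [|i _];
  [exists 0%N|apply: measurableI; [exact: mpre|exact: mprex]].
Qed.

Lemma other_eventsT : other_events setT.
Proof.
exists 0%N, (fun=> setT), (fun=> setT); split => //.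
by apply/seteqP; split => // w _ i.
Qed.

Lemma other_eventsI : setI_closed other_events.
Proof.
move=> _ _ [K [U [E [mU mE E0 ->]]]] [K' [U' [E' [mU' mE' E0' ->]]]].
pose U2 i := (if (i < K)%N then U i else setT) `&` (if (i < K')%N then U' i else setT).
pose E2 i := (if (i < K)%N then E i else setT) `&` (if (i < K')%N then E' i else setT).
exists (maxn K K'), U2, E2; split.
- by move=> i; apply: measurableI; case: ifP.
- by move=> i; apply: measurableI; case: ifP.
- by rewrite /E2 E0 E0'; do 2 case: ifP => _; rewrite setIT.
apply/seteqP; split => w /=.
  move=> [h h'] i /= iK; rewrite /U2 /E2; split; split; case: ifP => //.
  + by move=> /h[].
  + by move=> /h'[].
  + by move=> /h[].
  + by move=> /h'[].
move=> h; split => i /= iK.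
  have [|] := h i; first by rewrite /= leq_max iK.
  by rewrite /U2 /E2 iK => -[? _] [? _].
have [|] := h i; first by rewrite /= leq_max iK orbT.
by rewrite /U2 /E2 iK => -[_ ?] [_ ?].
Qed.

(** Both sides are measures in [C] that agree on a generating family closed
    under intersection. *)
Lemma first_jump_independent A C : measurable A -> <<s other_events >> C ->
  P (xi 0 @^-1` A `&` C) = (P (xi 0 @^-1` A) * P C)%E.
Proof.
move=> mA sC; have mD := mprex 0 mA.
have mC : measurable C.
  have := sC; apply: smallest_sub => //; first exact: sigma_algebra_measurable.
  exact: other_events_measurable.
have r0 : 0 <= fine (P (xi 0 @^-1` A)) by rewrite fine_ge0.
rewrite setIC -[X in (X * _)%E]fineK ?fin_num_measure//.
rewrite -[LHS]/(mrestr P mD C) -[RHS]/(mscale (NngNum r0) P C).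
apply: (@g_sigma_algebra_measure_unique _ _ _ other_events _ (fun=> setT)) => //.
- exact: other_events_measurable.
- by move=> _; exact: other_eventsT.
- by rewrite bigcup_const//; exists 0%N.
- exact: other_eventsI.
- move=> _ [[|K] [U [E [mU mE E0 ->]]]].
    rewrite (_ : \bigcap_(i < 0) _ = setT); last by apply/seteqP; split => // w _ i.
    rewrite /= /mrestr /mscale /= setTI probability_setT mule1 fineK//.
    exact: fin_num_measure.
  pose E' i := if i is 0%N then A else E i.
  have mE' i : measurable (E' i) by rewrite /E'; case: i.
  have mB F : (forall i, measurable (F i)) ->
     measurable (\bigcap_(i < K.+1) (T i @^-1` U i `&` xi i @^-1` F i)).
    move=> mF; apply: bigcap_measurable => [|i _]; first by exists 0%N.
    by apply: measurableI; [exact: mpre|exact: mprex].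
  rewrite /= /mrestr /mscale /=.
  have -> : \bigcap_(i < K.+1) (T i @^-1` U i `&` xi i @^-1` E i) `&` xi 0 @^-1` A =
      \bigcap_(i < K.+1) (T i @^-1` U i `&` xi i @^-1` E' i).
    apply/seteqP; split => w /=.
      by move=> [h Aw] [|i] iK; have [? ?] := h _ iK.
    move=> h; split=> [i iK|]; last by have [] := h 0%N (ltn0Sn K).
    by have [hT hx] := h _ iK; split => //; case: i iK hT hx => [|i] //; rewrite E0.
  rewrite -[LHS]fineK ?fin_num_measure//; last exact: mB.
  rewrite -[X in (_ * X)%E]fineK ?fin_num_measure//; last exact: mB.
  rewrite -EFinM; congr EFin; rewrite !Txi// !big_ord_recl /= E0 preimage_setT.
  by rewrite probability_setT /=; ring.
- by move=> _; rewrite /= /mrestr setTI ltey_eq fin_num_measure.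
Qed.

End arrival_times.

(** * Paths of a compound Poisson process *)

Section partial_sums.
Context (R : realType) (T : nat -> R).
Hypothesis T0 : forall i, 0 < T i.

Lemma psum_lt i j : (i < j)%N -> \sum_(l < i) T l < \sum_(l < j) T l.
Proof.
move=> ij; rewrite -(subnKC ij) big_split_ord /= big_ord_recr /=.
rewrite -addrA ltrDl ltr_wpDr ?T0//.
by apply: sumr_ge0 => l _; exact: ltW.
Qed.

Lemma psum_le i j : (\sum_(l < i) T l <= \sum_(l < j) T l) = (i <= j)%N.
Proof.
apply/idP/idP => [|].
  by apply: contraTT; rewrite -ltnNge -ltNge; exact: psum_lt.
by rewrite leq_eqVlt => /predU1P[->//|/psum_lt/ltW].
Qed.

Lemma psum_between t : (exists j, t < \sum_(l < j) T l) -> 0 <= t ->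
  exists j, \sum_(l < j) T l <= t < \sum_(l < j.+1) T l.
Proof.
move=> ex t0; case: (ex_minnP ex) => -[|j].
  by rewrite big_ord0 ltNge t0.
move=> tj jmin; exists j; rewrite tj andbT leNgt.
by apply/negP => /jmin; rewrite ltnn.
Qed.

End partial_sums.

Section jump_paths.
Context (R : realType) (k : nat) (T : nat -> R) (x : nat -> 'cV[R]_k)
  (y : R -> 'cV[R]_k).

(** What holds almost surely for a compound Poisson path; a first jump of size
    zero would not be a discontinuity. *)
Definition jump_path :=
  [/\ forall i, 0 < T i,
      forall t, exists j, t < \sum_(i < j) T i,
      forall t j, 0 <= t -> \sum_(i < j) T i <= t < \sum_(i < j.+1) T i ->
        y t = \sum_(i < j) x i &
      x 0%N <> 0].

Hypothesis yP : jump_path.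

Let T0 i : 0 < T i. Proof. by have [] := yP. Qed.

Lemma jump_path_before t : 0 <= t -> t < T 0%N -> y t = 0.
Proof.
move=> t0 tT; have [_ _ h _] := yP; rewrite (h _ 0%N)//.
  by rewrite big_ord0.
by rewrite big_ord0 big_ord1 t0.
Qed.

Lemma jump_path_first t : T 0%N <= t -> t < T 0%N + T 1%N -> y t = x 0%N.
Proof.
move=> t0 tT; have [_ _ h _] := yP; rewrite (h _ 1%N).
- by rewrite big_ord1.
- by rewrite (le_trans _ t0)// ltW.
- by rewrite big_ord1 !big_ord_recl big_ord0 addr0 t0.
Qed.

Lemma first_jump_timeE : first_jump_time y = (T 0%N)%:E.
Proof.
have [_ _ _ x0] := yP.
apply/eqP; rewrite eq_le; apply/andP; split.
  apply: ereal_inf_lbound; exists (T 0%N) => //; split => // yT.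
  rewrite jump_path_first// ?ltrDl// in yT.
  have y0 : y s @[s --> (T 0%N)^'-] --> (0 : 'cV[R]_k).
    apply: cvg_near_cst; near=> s; apply: jump_path_before.
      by near: s; exact: nbhs_left_ge.
    by near: s; exact: nbhs_left_lt.
  by apply: x0; exact: (cvg_unique _ yT y0).
apply: le_ereal_inf_tmp => _ [t [t0 tj] <-]; rewrite lee_fin leNgt; apply/negP => tT.
apply: tj; rewrite jump_path_before ?ltW//.
apply: cvg_near_cst; near=> s; apply: jump_path_before.
  by near: s; exact: nbhs_left_ge.
by apply: lt_trans tT; near: s; exact: nbhs_left_lt.
Unshelve. all: by end_near. Qed.

(** Observing the path at the rational times before [t], and at [t], suffices
    to know whether it has jumped. *)
Lemma jump_path_seen t : 0 <= t ->
  (T 0%N <= t) <->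
  (y t <> 0 \/ exists q : rat, (0 : R) <= ratr q <= t /\ y (ratr q) <> 0).
Proof.
move=> t0; have [_ _ _ x0] := yP; split; last first.
  move=> h; rewrite leNgt; apply/negP => tT; case: h => [|[q [/andP[q0 qt]]]].
    by apply; exact: jump_path_before.
  by apply; apply: jump_path_before => //; exact: le_lt_trans tT.
rewrite le_eqVlt => /predU1P[Tt|Tt].
  by left; rewrite jump_path_first -?Tt ?ltrDl.
have /rat_in_itvoo[q] : T 0%N < Num.min t (T 0%N + T 1%N).
  by rewrite lt_min Tt ltrDl T0.
rewrite in_itv /= lt_min => /and3P[Tq qt qT].
right; exists q; rewrite (ltW qt) (le_trans _ (ltW Tq))/= ?ltW//.
by rewrite jump_path_first// ltW.
Qed.

(** The later arrivals and jumps determine the path without its first jump. Their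
    number up to time [t] is random, whence a series. *)
Lemma jump_path_rest t i : 0 <= t ->
  \sum_(l < K) (if \sum_(m < l.+2) T m <= t then x l.+1 i 0 else 0)
    @[K --> \oo] --> (y t - (if T 0%N <= t then x 0%N else 0)) i 0.
Proof.
move=> t0; have [_ unb h _] := yP.
have [j /andP[jt tj]] := psum_between (unb t) t0.
rewrite (h t j t0) ?jt//.
have lej l : (\sum_(m < l) T m <= t) = (l <= j)%N.
  apply/idP/idP => [lt|lj]; last by apply: le_trans jt; rewrite psum_le.
  by rewrite -ltnS ltnNge -(psum_le T0) -ltNge (le_lt_trans lt).
have -> : (T 0%N <= t) = (0 < j)%N by rewrite -lej big_ord1.
have tail (j' K : nat) : (j' <= K)%N ->
    \sum_(l < K) (if (l.+1 < j')%N then x l.+1 i 0 else 0) =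
    (\sum_(l < j') x l - (if (0 < j')%N then x 0%N else 0)) i 0.
  case: j' => [|j'] jK; first by rewrite big_ord0 subr0 mxE big1.
  rewrite big_ord_recl /= addrC addKr summxE.
  rewrite (big_ord_widen K (fun l => x l.+1 i 0)) ?(ltnW jK)//.
  by rewrite [RHS]big_mkcond.
apply: cvg_near_cst; near=> K.
under eq_bigr do rewrite lej.
by apply: tail; near: K; exact: nbhs_infty_ge.
Unshelve. all: by end_near. Qed.

Lemma jump_path_decomposition t : 0 <= t ->
  y t = (if T 0%N <= t then x 0%N else 0) + \col_i rlimsup
    (fun K => \sum_(l < K) (if \sum_(m < l.+2) T m <= t then x l.+1 i 0 else 0)).
Proof.
move=> t0; apply/matrixP => i j; rewrite ord1 [RHS]mxE [X in _ + X]mxE.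
by rewrite (cvg_rlimsup (@jump_path_rest t i t0)) !mxE addrC subrK.
Qed.

End jump_paths.

(** * Isolating the first jump *)

Section pathwise.
Context (R : realType).

Lemma cvg_entry m n (F : set_system R) (y : R -> 'M[R]_(m, n)) (l : 'M[R]_(m, n)) i j :
  Filter F -> y s @[s --> F] --> l -> y s i j @[s --> F] --> l i j.
Proof.
move=> FF yl; apply: (@cvg_comp _ _ _ y (fun M : 'M[R]_(m, n) => M i j) _ _ _ yl).
exact: coord_continuous.
Qed.

Lemma cadlag_regular m (y : R -> 'cV[R]_m) : cadlag y -> regular y.
Proof.
move=> [ry ly] i; apply: cadlag_rc_lb => [t t0|t t0].
  by apply: cvg_entry; exact: ry.
have /cvg_ex[l yl] := ly t t0.
by apply/cvg_ex; exists (l i 0); apply: cvg_entry.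
Qed.

Lemma eq_regular m (y z : R -> 'cV[R]_m) : (forall s, 0 <= s -> y s = z s) ->
  regular y -> regular z.
Proof. by move=> yz ry i; apply: eq_rc_lb (ry i) => s s0; rewrite yz. Qed.

Lemma regular_jump m S (x : 'cV[R]_m) : regular (fun s => if S <= s then x else 0).
Proof.
move=> i; apply: eq_rc_lb (rc_lbZ (x i 0) (rc_lb_ramp S 0)) => s _.
by rewrite /ramp; case: ifP; rewrite ?expr0 ?fact0 ?divr1 ?mulr1 ?mulr0 ?mxE.
Qed.

(** Variation of constants: by linearity the responses to the starting point and
    to the noise add up. *)
Lemma OU_response n (A : 'M[R]_n) (x : 'cV[R]_n) (X y : R -> 'cV[R]_n) t :
  regular X -> regular y -> 0 <= t ->
  (forall s, 0 <= s -> forall i, X s i 0 = x i 0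
     + \int[lebesgue_measure]_(r in `[0, s]) (A *m X r) i 0 + y s i 0) ->
  X t = flow A t *m x + response A y t.
Proof.
move=> rX ry t0 eX.
rewrite -response_cst// -responseD//; last exact: regular_cst.
apply: linear_equation_response => //.
  by apply: regularD => //; exact: regular_cst.
move=> s s0; rewrite -vprimM//; apply/matrixP => i j; rewrite ord1 eX//.
rewrite ![in RHS]mxE /prim addrAC; congr (_ + _ + _).
Qed.

End pathwise.

Section sigma_algebras.
Context dO (Omega : measurableType dO) (R : realType).

Lemma measurable_coarse d (T : measurableType d) (G : set_system Omega)
    (Y : g_sigma_algebraType G -> T) :
  G `<=` measurable -> measurable_fun setT Y ->
  measurable_fun [set: Omega] (Y : Omega -> T).
Proof.
move=> Gm mY _ U mU; rewrite setTI.
have : <<s G >> (Y @^-1` U) by have := mY measurableT U mU; rewrite setTI.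
by apply: smallest_sub => //; exact: sigma_algebra_measurable.
Qed.

Lemma preimage_coarse d (T : measurableType d) (G : set_system Omega)
    (Y : g_sigma_algebraType G -> T) (U : set T) :
  measurable_fun setT Y -> measurable U -> <<s G >> (Y @^-1` U).
Proof. by move=> mY mU; have := mY measurableT U mU; rewrite setTI. Qed.

Lemma measurable_set1_cV m : measurable ([set 0] : set 'cV[R]_m).
Proof.
rewrite (_ : [set 0] = @enorm R m @^-1` [set 0]).
  by rewrite -[X in measurable X]setTI; apply: measurable_enorm => //; exact: measurable_set1.
by apply/seteqP; split => x /=; [move=> ->; rewrite enorm0|exact: enorm_eq0].
Qed.

Lemma process_events_sub m (L : R -> Omega -> 'cV[R]_m) :
  (forall t, 0 <= t -> measurable_fun setT (L t)) ->
  process_events L `<=` measurable.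
Proof.
move=> mL _ [t [E [t0 mE ->]]].
by rewrite -[X in measurable X]setTI; exact: mL.
Qed.

(** Measurability for the sigma-algebra to which the independence of processes
    refers. *)
Lemma process_adapted m (L : R -> Omega -> 'cV[R]_m) t : 0 <= t ->
  measurable_fun setT (L t : g_sigma_algebraType (process_events L) -> 'cV[R]_m).
Proof.
move=> t0 _ U mU; rewrite setTI; apply: sub_sigma_algebra.
by exists t, U.
Qed.

Lemma measurable_cst_mulmx d (T : measurableType d) m n (B : 'M[R]_(m, n))
    (y : T -> 'cV[R]_n) : measurable_fun setT y ->
  measurable_fun setT (fun w => B *m y w).
Proof. by move=> my; apply: measurable_mxM => //; exact: measurable_cst. Qed.

End sigma_algebras.

Section representation.
Context dO (Omega : measurableType dO) (R : realType) (P : probability Omega R).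
Context (n k : nat) (A : 'M[R]_n) (B : 'M[R]_(n, k)).
Context (nu0 : {measure set 'cV[R]_k -> \bar R}) (rho0 : 'cV[R]_k -> R) (lam0 : R).
Context (L L1 L0 : R -> Omega -> 'cV[R]_k) (X : 'cV[R]_n -> R -> Omega -> 'cV[R]_n).
Hypothesis mrho : measurable_fun setT rho0.
Hypothesis rho_gt0 : forall z, 0 < rho0 z.
Hypothesis nu0E : forall E, measurable E ->
  nu0 E = (\int[lebesgue_cV R k]_(z in E) (rho0 z)%:E)%E.
Hypothesis nu0T : nu0 setT = lam0%:E.
Hypothesis lam0_gt0 : 0 < lam0.
Hypothesis nu00 : nu0 [set 0] = 0%E.
Hypothesis levyL : levy_process P L.
Hypothesis levyL1 : levy_process P L1.
Hypothesis mL0 : forall t, 0 <= t -> measurable_fun setT (L0 t).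
Hypothesis indL : independent_processes P L1 L0.
Hypothesis sumL : {ae P, forall w, forall t, 0 <= t -> L t w = L1 t w + L0 t w}.
Hypothesis solX : forall x, solves_OU P A B L x (X x).
Context (T : nat -> Omega -> R) (xi : nat -> Omega -> 'cV[R]_k).
Hypothesis mT : forall i, measurable_fun setT (T i).
Hypothesis mxi : forall i, measurable_fun setT (xi i).
Hypothesis Txi : forall (K : nat) (U : nat -> set R) (E : nat -> set 'cV[R]_k),
  (forall i, measurable (U i)) -> (forall i, measurable (E i)) ->
  fine (P (\bigcap_(i < K) (T i @^-1` U i `&` xi i @^-1` E i))) =
  \prod_(i < K) (fine (P (T i @^-1` U i)) * fine (P (xi i @^-1` E i))).
Hypothesis expT : forall i (U : set R), measurable U ->
  P (T i @^-1` U) = exponential_prob (fine (nu0 setT)) U.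
Hypothesis lawxi : forall i (E : set 'cV[R]_k), measurable E ->
  P (xi i @^-1` E) = (nu0 E / nu0 setT)%E.
Hypothesis pathL0 : {ae P, forall w, forall t (j : nat), 0 <= t ->
  \sum_(i < j) T i w <= t < \sum_(i < j.+1) T i w ->
  L0 t w = \sum_(i < j) xi i w}.
Variable t : R.
Hypothesis t_gt0 : 0 < t.

Let expT' i (U : set R) : measurable U -> P (T i @^-1` U) = exponential_prob lam0 U.
Proof. by move=> mU; rewrite expT// nu0T. Qed.

Let rho z := rho0 z / lam0.

Lemma jump_law E : measurable E ->
  P (xi 0 @^-1` E) = (\int[leb (n := k)]_(z in E) (rho z)%:E)%E.
Proof.
move=> mE; rewrite lawxi// nu0T nu0E// inver gt_eqF// muleC.
rewrite -ge0_integralZl_EFin//.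
- by apply: eq_integral => z _; rewrite -EFinM /rho mulrC.
- by move=> z _; rewrite lee_fin ltW.
- exact/measurable_EFinP/measurable_funTS.
- by rewrite invr_ge0 ltW.
Qed.

Lemma ae_jump_path :
  {ae P, forall w, jump_path (T ^~ w) (xi ^~ w) (L0 ^~ w)}.
Proof.
have xi0 : {ae P, forall w, xi 0%N w <> 0}.
  exists (xi 0%N @^-1` [set 0]); split.
  - by rewrite -[X in measurable X]setTI; apply: mxi => //; exact: measurable_set1_cV.
  - have m0 := @measurable_set1_cV R k.
    by transitivity (nu0 [set (0%R : 'cV[R]_k)] / nu0 setT)%E; [exact: lawxi|rewrite nu00 mul0e].
  - by move=> w /= /contrapT.
have tp := wait_gt0 mT expT'.
have unb := arrival_unbounded lam0_gt0 mT mxi Txi expT'.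
apply: filterS2 (filterI tp unb) (filterI pathL0 xi0).
by move=> w [wtp wunb] [wpath wxi]; split.
Qed.

(** [L0] without its first jump is driven by the other arrivals and jumps. *)
Let rest s w : 'cV[R]_k := \col_i rlimsup (fun K => \sum_(l < K)
  (if \sum_(m < l.+2) T m w <= s then xi l.+1 w i 0 else 0)).

Let measurable_wait_other i :
  measurable_fun setT (T i : g_sigma_algebraType (other_events T xi) -> R).
Proof.
move=> _ U mU; rewrite setTI; apply: sub_sigma_algebra.
exists i.+1, (fun l => if l == i then U else setT), (fun=> setT); split => //.
  by move=> l; case: ifP.
apply/seteqP; split => w /=.
  by move=> Uw l _; split => //; case: ifPn => // /eqP ->.
by move=> /(_ i (ltnSn i)) [] /=; rewrite eqxx.
Qed.

Let measurable_jump_other i :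
  measurable_fun setT
    (xi i.+1 : g_sigma_algebraType (other_events T xi) -> 'cV[R]_k).
Proof.
move=> _ U mU; rewrite setTI; apply: sub_sigma_algebra.
exists i.+2, (fun=> setT), (fun l => if l == i.+1 then U else setT); split => //.
  by move=> l; case: ifP.
apply/seteqP; split => w /=.
  by move=> Uw l _; split => //; case: ifPn => // /eqP ->.
by move=> /(_ i.+1 (ltnSn _)) [] /= _; rewrite eqxx.
Qed.

Let measurable_rest s :
  measurable_fun setT
    (rest s : g_sigma_algebraType (other_events T xi) -> 'cV[R]_k).
Proof.
apply: measurable_mxP => // i j; under eq_fun do rewrite mxE.
apply: (@measurable_rlimsup R _ (g_sigma_algebraType (other_events T xi))
  (fun K w => \sum_(l < K) (if \sum_(m < l.+2) T m w <= s then xi l.+1 w i 0 else 0))) => K.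
apply: measurable_sum => l; apply: measurable_fun_ifT.
- apply: measurable_fun_ler => //.
  by apply: measurable_sum => m; exact: measurable_wait_other.
- apply: measurable_mx_entry; exact: measurable_jump_other.
- exact: measurable_cst.
Qed.

(** Almost surely the event that the first arrival is not after [t], written in
    terms of [L0] alone: independence is known for [L1] and [L0], and not for [L1]
    and the arrival times. *)
Definition seen_event : set Omega :=
  [set w | L0 t w <> 0 \/ exists q : rat, (0 : R) <= ratr q <= t /\ L0 (ratr q) w <> 0].

Lemma seen_eventE : <<s process_events L0 >> seen_event.
Proof.
have t0 := ltW t_gt0.
have e s : 0 <= s -> <<s process_events L0 >> [set w | L0 s w <> 0].
  move=> s0; apply: sub_sigma_algebra; exists s, (~` [set 0]); split => //.
  by apply: measurableC; exact: measurable_set1_cV.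
have -> : seen_event = [set w | L0 t w <> 0] `|` \bigcup_(q in [set: rat])
    (if (0 : R) <= ratr q <= t then [set w | L0 (ratr q) w <> 0] else set0).
  apply/seteqP; split => w [h|]; [by left|by move=> [q [qt h]]; right; exists q => //; rewrite qt|by left|].
  by move=> [q _]; case: ifP => // qt h; right; exists q.
apply: (@measurableU _ (g_sigma_algebraType (process_events L0))); first exact: e.
apply: (@bigcupT_measurable_rat _ (g_sigma_algebraType (process_events L0))) => q.
case: ifP => [/andP[q0 _]|_]; first exact: e.
exact: (@measurable0 _ (g_sigma_algebraType (process_events L0))).
Qed.

(** The noise of [L1], the noise of [L0], and the noise of [L0] stripped of its
    first jump, as measurable functions of what they depend on. *)
Lemma noise_decomposition : exists Y1 Y0 W0 : Omega -> 'cV[R]_n,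
  [/\ measurable_fun setT (Y1 : g_sigma_algebraType (process_events L1) -> 'cV[R]_n),
      measurable_fun setT (Y0 : g_sigma_algebraType (process_events L0) -> 'cV[R]_n),
      measurable_fun setT (W0 : g_sigma_algebraType (other_events T xi) -> 'cV[R]_n),
      forall x, {ae P, forall w, X x t w = flow A t *m x + (Y1 w + Y0 w)} &
      {ae P, forall w, Y0 w = (if T 0%N w <= t
        then flow A (t - T 0%N w) *m (B *m xi 0%N w) else 0) + W0 w}].
Proof.
have t0 := ltW t_gt0.
have [Y1 mY1 Y1E] := @measurable_response R n _
  (g_sigma_algebraType (process_events L1)) A (fun s w => B *m L1 s w) t
  (fun s s0 => measurable_cst_mulmx B (process_adapted (L := L1) s0)) t0.
have [Y0 mY0 Y0E] := @measurable_response R n _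
  (g_sigma_algebraType (process_events L0)) A (fun s w => B *m L0 s w) t
  (fun s s0 => measurable_cst_mulmx B (process_adapted (L := L0) s0)) t0.
have [W0 mW0 W0E] := @measurable_response R n _
  (g_sigma_algebraType (other_events T xi)) A (fun s w => B *m rest s w) t
  (fun s _ => measurable_cst_mulmx B (measurable_rest s)) t0.
have [_ _ _ _ cL] := levyL; have [_ _ _ _ cL1] := levyL1.
have reg : {ae P, forall w, regular (L1 ^~ w) /\ regular (L0 ^~ w)}.
  apply: filterS2 (filterI cL cL1) sumL => w [/cadlag_regular rL /cadlag_regular rL1] Lw.
  split=> //; apply: (@eq_regular _ _ (fun s => L s w + (- 1)%:M *m L1 s w)).
    move=> s s0; rewrite Lw// mul_scalar_mx scaleN1r addrAC subrr add0r//.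
  by apply: regularD => //; exact: regular_mulmx.
exists Y1, Y0, W0; split=> //.
- move=> x; apply: filterS2 (filterI reg sumL) (solX x).2 => w [[rL1 rL0] Lw] [cX eX].
  have rB1 := regular_mulmx B rL1; have rB0 := regular_mulmx B rL0.
  rewrite Y1E// Y0E// -responseD//.
  apply: (@OU_response R n A x (X x ^~ w) (fun s => B *m L1 s w + B *m L0 s w)) => //.
  - exact: cadlag_regular.
  - exact: regularD.
  - by move=> s s0 i; rewrite eX// Lw// mulmxDr.
- apply: filterS2 reg ae_jump_path => w [_ rL0] jw.
  have T0 : 0 <= T 0%N w by have [/(_ 0%N)/ltW] := jw.
  have dec s : 0 <= s -> L0 s w =
      (if T 0%N w <= s then xi 0%N w else 0) + rest s w.
    by move=> s0; exact: (jump_path_decomposition jw).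
  have rrest : regular (rest ^~ w).
    apply: (@eq_regular _ _ (fun s => L0 s w +
       (- 1)%:M *m (if T 0%N w <= s then xi 0%N w else 0))).
      by move=> s s0; rewrite dec// mul_scalar_mx scaleN1r addrAC subrr add0r.
    by apply: regularD => //; apply: regular_mulmx; exact: regular_jump.
  have rBrest := regular_mulmx B rrest; have rB0 := regular_mulmx B rL0.
  rewrite Y0E// W0E//.
  rewrite -(response_jump A (B *m xi 0%N w) T0 t0) -responseD//; last exact: regular_jump.
  apply: eq_response => // s s0; rewrite dec// mulmxDr.
  by case: ifP; rewrite ?mulmx0.
Qed.

Let P1t := P1 P X (fun w => first_jump_time (L0 ^~ w)) t.

(** The noise of [L1], the first arrival with the other jumps, and the first jump
    are independent. The first two are put on a product space; the third is
    integrated against its density, which is the integral in [smear]. *)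
Lemma representation : exists (W : Omega * Omega -> 'cV[R]_n)
    (tau : Omega * Omega -> R),
  let J := [set w | tau w \in `[0, t]] in
  [/\ measurable_fun setT W, measurable_fun setT tau,
      (P \x P)%E J = (1 - expR (- (lam0 * t)))%:E,
      forall (f : 'cV[R]_n -> R) x, measurable_fun setT f -> (forall z, 0 <= f z) ->
        P1t f x = smear (P \x P)%E (fun w => flow A (t - tau w) *m B) W J rho f
          (flow A t *m x) &
      forall (f : 'cV[R]_n -> R) x, measurable_fun setT f ->
        (`|P1t f x| <= P1t (fun z => `|f z|%R) x)%E].
Proof.
have t0 := ltW t_gt0.
have [Y1 [Y0 [W0 [mY1 mY0 mW0 XE Y0E]]]] := noise_decomposition.
have Gm1 := process_events_sub (let: And5 m _ _ _ _ := levyL1 in m).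
have Gm0 := process_events_sub mL0.
have GmT : other_events T xi `<=` measurable by move=> C; exact: other_events_measurable.
have mY1' := measurable_coarse Gm1 mY1.
have mY0' := measurable_coarse Gm0 mY0.
have mW0' := measurable_coarse GmT mW0.
have mseen : measurable seen_event.
  have := seen_eventE; apply: smallest_sub => //; exact: sigma_algebra_measurable.
pose c (x : 'cV[R]_n) := flow A t *m x.
pose h (f : 'cV[R]_n -> R) x w : R := f (c x + (Y1 w + Y0 w)) * \1_seen_event w.
have P1E f x : P1t f x = (\int[P]_w (h f x w)%:E)%E.
  apply: eq_integral_ae; apply: filterS2 ae_jump_path (XE x) => w jw ->.
  rewrite /h !indicE; congr (_ * _)%:E; congr (nat_of_bool _)%:R.
  rewrite (_ : (_ \in [set w | _]) = (T 0%N w <= t)); last first.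
    by apply/idP/idP; rewrite inE /= (first_jump_timeE jw) lee_fin.
  have s := jump_path_seen jw t0.
  by apply/idP/idP => [/s|]; rewrite inE //; move/s.
have mh f x : measurable_fun setT f -> measurable_fun setT (h f x).
  move=> mf; apply: measurable_funM; last exact: measurable_indic.
  apply: measurableT_comp => //; apply: measurable_mxD => //.
  exact: measurable_mxD.
exists (fun w => Y1 w.1 + W0 w.2), (fun w => T 0%N w.2) => J.
have mJ2 : measurable (T 0%N @^-1` `[0, t]%classic).
  by rewrite -[X in measurable X]setTI; apply: mT => //; exact: measurable_itv.
have mW : measurable_fun [set: Omega * Omega] (fun w => Y1 w.1 + W0 w.2).
  apply: measurable_mxD => //.
    exact: (measurableT_comp mY1' measurable_fst).
  exact: (measurableT_comp mW0' measurable_snd).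
have mtau : measurable_fun [set: Omega * Omega] (fun w => T 0%N w.2).
  exact: (measurableT_comp (mT 0) measurable_snd).
split=> //.
- have -> : J = setT `*` (T 0%N @^-1` `[0, t]%classic).
    by apply/seteqP; split => w /=; [move=> h'; split|case].
  transitivity (P [set: Omega] * P (T 0%N @^-1` `[0%R, t]%classic))%E.
    exact: product_measure1E.
  rewrite probability_setT mul1e.
  exact: (prob_wait expT' 0 t_gt0).
- move=> f x mf f0; rewrite P1E.
  (* the indicator is squared so that [F] is nonnegative for all real values
     of its last argument *)
  pose F (p : 'cV[R]_n * ('cV[R]_n * measurableTypeR R)) : \bar R :=
    (f (c x + (p.1 + p.2.1)) * p.2.2 ^+ 2)%:E.
  have mp2 : measurable_fun setT
      (snd : 'cV[R]_n * ('cV[R]_n * measurableTypeR R) -> _) by exact: measurable_snd.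
  have mF : measurable_fun setT F.
    apply/measurable_EFinP; apply: measurable_funM.
      apply: measurableT_comp => //; apply: measurable_mxD => //.
      apply: measurable_mxD => //.
      exact: (measurableT_comp measurable_fst mp2).
    apply: measurable_funX; exact: (measurableT_comp measurable_snd mp2).
  have F0 p : (0 <= F p)%E by rewrite lee_fin mulr_ge0// sqr_ge0.
  pose Z w : 'cV[R]_n * measurableTypeR R := (Y0 w, \1_seen_event w).
  have mZ : measurable_fun setT
      (Z : g_sigma_algebraType (process_events L0) -> 'cV[R]_n * measurableTypeR R).
    apply: measurable_fun_pair => //.
    exact: (@measurable_indic _ (g_sigma_algebraType (process_events L0)) R setT _ seen_eventE).
  have sqr1 w : (\1_seen_event w : R) ^+ 2 = \1_seen_event w.
    by rewrite indicE; case: (_ \in _); rewrite ?expr1n// expr0n.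
  transitivity (\int[P]_w F (Y1 w, Z w))%E.
    by apply: eq_integral => w _; rewrite /F /= sqr1.
  rewrite (ge0_integral_independent mY1' (measurable_coarse Gm0 mZ))//; last first.
    move=> U V mU mV; apply: indL.
      exact: (preimage_coarse mY1).
    exact: (preimage_coarse mZ).
  have mG : measurable_fun [set: Omega * Omega] (fun w => flow A (t - T 0%N w.2) *m B).
    apply: measurable_mxM => //; apply: measurableT_comp; first exact: measurable_flow.
    exact: measurable_funB.
  have mJ : measurable J.
    by have := mtau measurableT _ (measurable_itv `[0, t]); rewrite setTI.
  have mrho' : measurable_fun setT rho by apply: measurable_funM.
  have rho'_gt0 z : 0 < rho z by rewrite divr_gt0.
  pose I (p : Omega * Omega * 'cV[R]_k) : \bar R := (f (c x + landing
    (fun w => flow A (t - T 0%N w.2) *m B) (fun w => Y1 w.1 + W0 w.2) p)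
    * \1_J p.1 * rho p.2)%:E.
  have mI : measurable_fun setT I.
    by apply/measurable_EFinP; exact: measurable_smear.
  have I0 p : (0 <= I p)%E.
    by rewrite lee_fin (mulr_ge0 _ (ltW (rho'_gt0 _)))// mulr_ge0.
  have -> : smear (P \x P)%E (fun w => flow A (t - T 0%N w.2) *m B)
      (fun w => Y1 w.1 + W0 w.2) J rho f (flow A t *m x) =
    (\int[P]_w1 \int[P]_w2 \int[leb (n := k)]_z I ((w1, w2), z))%E.
    pose PP : probability (Omega * Omega)%type R := (P \x P)%E.
    have e1 := @fubini_tonelli1 _ _ _ _ R PP (@leb R k) I mI I0.
    rewrite [LHS]e1.
    have mI1 := @measurable_fun_fubini_tonelli_F _ _ _ _ R (@leb R k) I mI I0.
    rewrite (@fubini_tonelli1 _ _ _ _ R P P _ mI1)// => p.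
    exact: integral_ge0.
  apply: eq_integral => w1 _.
  pose H w : measurableTypeR R * 'cV[R]_n := (T 0%N w, W0 w).
  have mH : measurable_fun setT
      (H : g_sigma_algebraType (other_events T xi) -> measurableTypeR R * 'cV[R]_n).
    by apply: measurable_fun_pair => //; exact: measurable_wait_other.
  pose K (p : (measurableTypeR R * 'cV[R]_n) * 'cV[R]_k) : \bar R :=
    (f (c x + (Y1 w1 + (p.1.2 + flow A (t - p.1.1) *m (B *m p.2)))) *
      \1_`[0, t] p.1.1)%:E.
  have mK : measurable_fun setT K.
    have m1 : measurable_fun setT
      (fst : (measurableTypeR R * 'cV[R]_n) * 'cV[R]_k -> _) by exact: measurable_fst.
    have m11 := measurableT_comp measurable_fst m1.
    apply/measurable_EFinP; apply: measurable_funM; last first.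
      exact: (measurableT_comp (@measurable_indic _ _ R setT _ (measurable_itv _)) m11).
    apply: measurableT_comp => //; do 2 apply: measurable_mxD => //.
    apply: measurable_mxD => //; first exact: (measurableT_comp measurable_snd m1).
    apply: measurable_mxM => //.
      apply: measurableT_comp; first exact: measurable_flow.
      exact: measurable_funB.
    by apply: measurable_cst_mulmx; exact: measurable_snd.
  have K0 p : (0 <= K p)%E by rewrite lee_fin mulr_ge0.
  transitivity (\int[P]_w K (H w, xi 0%N w))%E.
    apply: eq_integral_ae; apply: filterS2 ae_jump_path Y0E => w jw Y0w.
    have T0 : 0 <= T 0%N w by have [/(_ 0%N)/ltW] := jw.
    rewrite /F /K /= sqr1 !indicE.
    have -> : (w \in seen_event) = (T 0%N w <= t).
      have s := jump_path_seen jw t0.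
      by apply/idP/idP => [|/s]; rewrite inE //; move/s.
    rewrite (_ : (_ \in `[0, t]%classic) = (T 0%N w <= t)); last first.
      by apply/idP/idP; rewrite inE /= in_itv /= T0.
    by rewrite Y0w; case: ifP => _; rewrite ?mulr0// [W0 w + _]addrC.
  rewrite (ge0_integral_independent (measurable_coarse GmT mH) (mxi 0))//; last first.
    move=> U V mU mV; rewrite setIC [RHS]muleC.
    apply: (first_jump_independent mT mxi Txi) => //; exact: (preimage_coarse mH).
  apply: eq_integral => w2 _.
  rewrite (@ge0_integral_density _ _ _ _ R P (@leb R k) (xi 0%N) rho (mxi 0%N) mrho'
    (fun z => ltW (rho'_gt0 z)) jump_law (fun z => K (H w2, z)))//; last first.
    exact: measurableT_comp.
  apply: eq_integral => z _; rewrite -EFinM; congr EFin.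
  rewrite /I /K /landing /= mulmxA -!addrA; congr (_ * _ * _).
- move=> f x mf; rewrite !P1E.
  apply: le_trans (le_abse_integral _ _ _) _ => //; first exact/measurable_EFinP/mh.
  rewrite le_eqVlt; apply/orP; left; apply/eqP; apply: eq_integral => w _.
  by rewrite /h /= normrM indicE (ger0_norm (ler0n _ _)).
Qed.

End representation.

(** * The weight and the two inequalities *)

Section weight.
Context (R : realType) (k : nat) (rho0 : 'cV[R]_k -> R) (lam0 p : R).
Hypothesis mrho : measurable_fun setT rho0.
Hypothesis rho_gt0 : forall z, 0 < rho0 z.
Hypothesis lam0_gt0 : 0 < lam0.
Hypothesis p_gt1 : 1 < p.

Let p1_gt0 : 0 < p - 1. Proof. by rewrite subr_gt0. Qed.

(** Normalizing the density by its mass only produces the factor in front of the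
    supremum in [V], because the two exponents differ by one. *)
Lemma V_upper z' r : enorm z' <= r ->
  (\int[leb (n := k)]_z ((rho0 (z - z') / lam0) `^ (p / (p - 1)) /
     (rho0 z / lam0) `^ (p - 1)^-1)%:E <= V rho0 lam0 p r)%E.
Proof.
move=> z'r.
pose h z := rho0 (z - z') `^ (p / (p - 1)) / rho0 z `^ (p - 1)^-1.
have h0 z : 0 <= h z by rewrite divr_ge0// powR_ge0.
have mh : measurable_fun setT h.
  apply: measurable_funM.
    apply: (measurableT_comp (measurable_powR _)).
    exact: (measurableT_comp mrho (measurable_shift_cV _)).
  under eq_fun do rewrite -powRN.
  exact: (measurableT_comp (measurable_powR _)).
have -> : (\int[leb (n := k)]_z ((rho0 (z - z') / lam0) `^ (p / (p - 1)) /
     (rho0 z / lam0) `^ (p - 1)^-1)%:E =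
   \int[leb (n := k)]_z (lam0^-1%:E * (h z)%:E))%E.
  apply: eq_integral => z _; rewrite -EFinM; congr EFin.
  have l0 : 0 <= lam0^-1 by rewrite invr_ge0 ltW.
  rewrite !powRM// 1?ltW// invfM mulrACA [RHS]mulrC; congr (_ * _).
  rewrite -powRN -powRD.
    rewrite (_ : _ - _ = 1) ?powRr1//.
    by field; rewrite subr_eq0 gt_eqF.
  by apply/implyP => _; rewrite gt_eqF// invr_gt0.
rewrite ge0_integralZl_EFin//; last by rewrite invr_ge0 ltW.
  apply: lee_wpmul2l; first by rewrite lee_fin invr_ge0 ltW.
  by apply: ereal_sup_ubound; exists z'.
- by move=> z _; rewrite lee_fin.
- exact/measurable_EFinP.
Qed.

(** At [z' = 0] the integrand is the density itself. *)
Lemma V_ge1 r : (\int[leb (n := k)]_z (rho0 z)%:E = lam0%:E)%E -> 0 <= r ->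
  (1 <= V rho0 lam0 p r)%E.
Proof.
move=> rho_lam r0; apply: le_trans (@V_upper 0 r _); last by rewrite enorm0.
rewrite le_eqVlt; apply/orP; left; apply/eqP.
transitivity (\int[leb (n := k)]_z (lam0^-1%:E * (rho0 z)%:E))%E.
  rewrite ge0_integralZl_EFin//.
  - by rewrite rho_lam -EFinM mulVf// gt_eqF.
  - by move=> z _; rewrite lee_fin ltW.
  - exact/measurable_EFinP.
  - by rewrite invr_ge0 ltW.
apply: eq_integral => z _; rewrite -EFinM subr0; congr EFin.
have rl0 : 0 < rho0 z / lam0 by rewrite divr_gt0.
rewrite -powRN -powRD; last by apply/implyP => _; rewrite gt_eqF.
rewrite (_ : _ - _ = 1); last by field; rewrite subr_eq0 gt_eqF.
by rewrite powRr1 ?(ltW rl0)// mulrC.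
Qed.

Lemma le_V r s : r <= s -> (V rho0 lam0 p r <= V rho0 lam0 p s)%E.
Proof.
move=> rs; apply: lee_wpmul2l; first by rewrite lee_fin invr_ge0 ltW.
by apply: le_ereal_sup => _ [z' /= z'r <-]; exists z' => //; exact: le_trans rs.
Qed.

Lemma V_ge0 r : 0 <= r -> (0 <= V rho0 lam0 p r)%E.
Proof.
move=> r0; apply: le_trans (@V_upper 0 r _); last by rewrite enorm0.
by apply: integral_ge0 => z _; rewrite lee_fin divr_ge0// powR_ge0.
Qed.

(** A nondecreasing function of the norm. *)
Lemma measurable_V_enorm n a : 0 <= a ->
  (forall r, 0 <= r -> (V rho0 lam0 p r < +oo)%E) ->
  measurable_fun setT (fun v : 'cV[R]_n => V rho0 lam0 p (a * enorm v)).
Proof.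
move=> a0 Voo.
have Vfin r : 0 <= r -> V rho0 lam0 p r \is a fin_num.
  by move=> r0; rewrite ge0_fin_numE ?Voo ?V_ge0.
pose g r := fine (V rho0 lam0 p (Num.max r 0)).
rewrite (_ : (fun v => _) = fun v : 'cV[R]_n => (g (a * enorm v))%:E).
  apply/measurable_EFinP/(measurableT_comp (f := g)).
    apply: nondecreasing_measurable => // r s rs.
    have m0 (x : R) : 0 <= Num.max x 0 by rewrite le_max lexx orbT.
    by rewrite fine_le ?Vfin// le_V// le_max2.
  by apply: measurable_funM => //; exact: measurable_enorm.
apply/funext => v; have av0 : 0 <= a * enorm v by rewrite mulr_ge0// enorm_ge0.
by rewrite /g max_l// fineK// Vfin.
Qed.

End weight.

Lemma lee_poweR_root (R : realType) (K I : \bar R) (a p : R) : 0 < p -> 0 <= a ->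
  (0 <= K)%E -> (0 < I)%E -> (K `^ p * I <= a%:E `^ p)%E ->
  (K <= a%:E * I^-1 `^ p^-1)%E.
Proof.
move=> p0 a0 K0 I0 KI.
have pV0 : 0 <= p^-1 by rewrite invr_ge0 ltW.
have KE : K = ((K `^ p) `^ p^-1)%E.
  by rewrite -poweRrM mulfV ?gt_eqF// poweRe1.
case: I I0 KI => [i| |//]; last first.
  move=> _; have [K0'|] := eqVneq K 0%E; first by rewrite K0' mule_ge0// poweR_ge0.
  move=> Kn0; have K_gt0 : (0 < K)%E by rewrite lt_def Kn0.
  by rewrite gt0_muley ?poweR_gt0// poweR_EFin.
rewrite lte_fin => i0 KI.
have {}KI : (K `^ p <= a%:E `^ p * i^-1%:E)%E.
  by rewrite lee_pdivlMr.
have iV0 : (0 <= i^-1%:E)%E by rewrite lee_fin invr_ge0 ltW.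
rewrite inver gt_eqF// {1}KE.
apply: le_trans (gt0_ler_poweR pV0 _ _ KI) _.
- by rewrite in_itv /= leey poweR_ge0.
- by rewrite in_itv; apply/andP; split; [exact: mule_ge0 (poweR_ge0 _ _) iV0|exact: leey].
rewrite poweRM ?poweR_ge0//.
by rewrite -poweRrM mulfV ?gt_eqF// poweRe1.
Qed.

Section first_jump_smoothing.
Context (R : realType) (n k : nat) (A : 'M[R]_n) (B : 'M[R]_(n, k)).
Context d (O : measurableType d) (Q : probability O R).
Variables (W : O -> 'cV[R]_n) (tau : O -> R) (t : R).
Variables (rho0 : 'cV[R]_k -> R) (lam0 : R).
Hypothesis rankB : \rank B = n.
Hypotheses (mW : measurable_fun setT W) (mtau : measurable_fun setT tau).
Hypothesis mrho : measurable_fun setT rho0.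
Hypothesis rho_gt0 : forall z, 0 < rho0 z.
Hypothesis rho_lam : (\int[leb (n := k)]_z (rho0 z)%:E = lam0%:E)%E.
Hypothesis lam0_gt0 : 0 < lam0.
Hypothesis t_gt0 : 0 < t.

Let J := [set w | tau w \in `[0, t]].
Let G w := flow A (t - tau w) *m B.
Let rho z := rho0 z / lam0.
Let S := smear Q G W J rho.
Let a1 := 1 - expR (- (lam0 * t)).
Hypothesis QJ : Q J = a1%:E.

Variable p : R.
Hypothesis p_gt1 : 1 < p.
Hypothesis V_fin : forall r, 0 <= r -> (V rho0 lam0 p r < +oo)%E.

Let c := 1 + opnorm (pinvmx B).

Let c_gt0 : 0 < c. Proof. by rewrite ltr_pwDl// opnorm_ge0. Qed.

Let a1_ge0 : 0 <= a1.
Proof. by rewrite subr_ge0 -expR0 ler_expR oppr_le0 mulr_ge0 ?ltW. Qed.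

Let mG : measurable_fun setT G.
Proof.
apply: measurable_mxM => //; apply: measurableT_comp; first exact: measurable_flow.
exact: measurable_funB.
Qed.

Let mJ : measurable J.
Proof. by have := mtau measurableT (measurable_itv `[0, t]); rewrite setTI. Qed.

Let m_rho : measurable_fun setT rho. Proof. exact: measurable_funM. Qed.
Let rho_gt0' z : 0 < rho z. Proof. exact: divr_gt0. Qed.

Let int_rho : (\int[leb (n := k)]_z (rho z)%:E = 1)%E.
Proof.
under eq_integral do rewrite /rho mulrC EFinM.
rewrite ge0_integralZl_EFin//.
- by rewrite rho_lam -EFinM mulVf// gt_eqF.
- by move=> z _; rewrite lee_fin ltW.
- exact/measurable_EFinP.
- by rewrite invr_ge0 ltW.
Qed.

(** As [pinvmx B] is a right inverse of [B], enlarging the first jump by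
    [pinvmx B *m flow A (tau - t) *m (u - u')] compensates at time [t] for the
    difference of the starting points. *)
Lemma first_jump_harnack (f : 'cV[R]_n -> R) u u' r :
  measurable_fun setT f -> (forall x, 0 <= f x) -> 0 <= r ->
  (forall s, 0 <= s <= t -> enorm (flow A (s - t) *m (u - u')) <= r) ->
  (S f u `^ p <= S (fun x => f x `^ p)%R u' * (a1%:E * V rho0 lam0 p (c * r)) `^ (p - 1))%E.
Proof.
move=> mf f0 r0 hr; rewrite -QJ.
have cr0 : 0 <= c * r by rewrite mulr_ge0// ltW.
have BK : B *m pinvmx B = 1%:M.
  by rewrite mulmxVp// /row_free rankB.
apply: (@smear_harnack _ _ _ _ _ Q _ _ _ _ mG mW mJ m_rho rho_gt0' p f u u'
    (fun w => pinvmx B *m (flow A (tau w - t) *m (u - u')))) => //.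
- apply: measurable_cst_mulmx; apply: measurable_mxM => //.
  apply: measurableT_comp; first exact: measurable_flow.
  exact: measurable_funB.
- move=> w _; rewrite /G -mulmxA (mulmxA B) BK mul1mx mulmxA flowD.
  by rewrite addrA subrK subrr flow0 mul1mx.
- exact: V_ge0.
- move=> w; rewrite /J /= in_itv /= => /hr h.
  apply: V_upper => //; apply: le_trans (ler_opnorm _ _) _.
  by apply: ler_pM; rewrite ?opnorm_ge0 ?enorm_ge0// lerDr.
Qed.

Let aT := expR (opnorm A * t).

Lemma smear_flow_harnack (f : 'cV[R]_n -> R) x y :
  measurable_fun setT f -> (forall x, 0 <= f x) ->
  (S f (flow A t *m x) `^ p <= S (fun z => f z `^ p)%R (flow A t *m y) *
    (a1%:E * V rho0 lam0 p (c * aT * enorm (x - y))) `^ (p - 1))%E.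
Proof.
move=> mf f0; rewrite -mulrA; apply: first_jump_harnack => //.
  by rewrite mulr_ge0 ?expR_ge0 ?enorm_ge0.
move=> s /andP[s0 st]; rewrite -mulmxBr mulmxA flowD subrK.
apply: le_trans (ler_enorm_flow _ _ _) _.
rewrite ler_wpM2r ?enorm_ge0// ler_expR ler_wpM2l ?opnorm_ge0//.
by rewrite ger0_norm.
Qed.

(** The comparison in terms of the displacement [v] at time [t]. Integrating over
    [v], rather than over the starting point, involves no Jacobian. *)
Lemma smear_shift_harnack (f : 'cV[R]_n -> R) u v :
  measurable_fun setT f -> (forall x, 0 <= f x) ->
  (S f u `^ p <= S (fun z => f z `^ p)%R (u + v) *
    (a1%:E * V rho0 lam0 p (c * aT * enorm v)) `^ (p - 1))%E.
Proof.
move=> mf f0; rewrite -mulrA; apply: first_jump_harnack => //.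
  by rewrite mulr_ge0 ?expR_ge0 ?enorm_ge0.
move=> s /andP[s0 st]; rewrite opprD addNKr mulmxN enormN.
apply: le_trans (ler_enorm_flow _ _ _) _.
rewrite ler_wpM2r ?enorm_ge0// ler_expR ler_wpM2l ?opnorm_ge0//.
by rewrite ler0_norm ?subr_le0// opprB gerBl.
Qed.

Let Vinv (v : 'cV[R]_n) := ((V rho0 lam0 p (c * aT * enorm v) `^ (p - 1))^-1)%E.
Let I := (\int[leb (n := n)]_v Vinv v)%E.

Let caT_ge0 : 0 <= c * aT. Proof. by rewrite mulr_ge0 ?expR_ge0 ?ltW. Qed.

Let V_gt0 (v : 'cV[R]_n) : (0 < V rho0 lam0 p (c * aT * enorm v))%E.
Proof.
by rewrite (@lt_le_trans _ _ 1%E)// V_ge1// mulr_ge0// ?enorm_ge0 ?mulr_ge0// ?ltW.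
Qed.

Let V_fin_num (v : 'cV[R]_n) : V rho0 lam0 p (c * aT * enorm v) \is a fin_num.
Proof. by rewrite gt0_fin_numE// V_fin// mulr_ge0// enorm_ge0. Qed.

Let V_fine_gt0 (v : 'cV[R]_n) : 0 < fine (V rho0 lam0 p (c * aT * enorm v)).
Proof. by rewrite -lte_fin fineK// V_fin_num. Qed.

Let VinvE (v : 'cV[R]_n) : Vinv v = ((fine (V rho0 lam0 p (c * aT * enorm v)) `^ (p - 1))^-1)%:E.
Proof.
rewrite /Vinv -[in LHS](fineK (V_fin_num v)) poweR_EFin inver gt_eqF// powR_gt0//.
Qed.

Let Vinv_gt0 (v : 'cV[R]_n) : (0 < Vinv v)%E.
Proof. by rewrite VinvE lte_fin invr_gt0 powR_gt0. Qed.

Let mVinv : measurable_fun setT Vinv.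
Proof.
rewrite (_ : Vinv = fun v : 'cV[R]_n =>
    (fine (V rho0 lam0 p (c * aT * enorm v)) `^ (- (p - 1)))%:E); last first.
  by apply/funext => v; rewrite VinvE powRN.
apply/measurable_EFinP/(measurableT_comp (measurable_powR _)).
by apply: (measurableT_comp (f := fine)) => //; exact: measurable_V_enorm.
Qed.

Lemma integral_Vinv_gt0 : (0 < I)%E.
Proof.
rewrite lt_def integral_ge0 ?andbT//; last by move=> v _; exact: ltW.
apply/eqP => I0.
have : ae_eq (leb (n := n)) setT Vinv (cst 0).
  apply/(ae_eq_integral_abs _ measurableT mVinv); rewrite -[RHS]I0.
  by apply: eq_integral => v _; rewrite gee0_abs// ltW.
move=> [N [mN N0 sub]].
have NT : N = setT.
  by apply/seteqP; split=> // v _; apply: sub => /(_ Logic.I) /eqP; rewrite gt_eqF.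
by move: (lebT_gt0 R n); rewrite -NT N0 ltxx.
Qed.

(** The inequality of [smear_shift_harnack] is divided by the power of the weight
    and integrated over [v]: on the right, [integral_smear] leaves the integral of
    [f^p] times the probability of [J]. *)
Lemma smear_sup_bound (f : 'cV[R]_n -> R) u :
  measurable_fun setT f -> (forall x, 0 <= f x) ->
  (\int[leb (n := n)]_v (f v `^ p)%:E <= 1)%E ->
  (S f u <= a1%:E * I^-1 `^ p^-1)%E.
Proof.
move=> mf f0 f1.
have mfp : measurable_fun setT (fun z => f z `^ p)
    by exact: (measurableT_comp (measurable_powR _)).
have fp0 x : 0 <= f x `^ p by exact: powR_ge0.
have S0 g v : (forall x, 0 <= g x) -> (0 <= S g v)%E.
  move=> g0; apply: integral_ge0 => x _.
  by rewrite lee_fin (mulr_ge0 _ (ltW (rho_gt0' _)))// mulr_ge0.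
apply: lee_poweR_root => //; first exact: lt_trans p_gt1.
- exact: S0.
- exact: integral_Vinv_gt0.
have Kp0 : (0 <= S f u `^ p)%E by exact: poweR_ge0.
have h v : (S f u `^ p * Vinv v <=
    (a1 `^ (p - 1))%:E * S (fun z => f z `^ p)%R (u + v))%E.
  have := smear_shift_harnack u v mf f0.
  rewrite poweRM ?lee_fin//; last exact: ltW.
  rewrite -(fineK (V_fin_num v)) !poweR_EFin muleA => H.
  rewrite VinvE lee_pdivrMr ?powR_gt0 ?V_fine_gt0//.
  by rewrite [X in (X * _)%E]muleC.
have -> : (S f u `^ p * I = \int[leb (n := n)]_v (S f u `^ p * Vinv v))%E.
  by rewrite ge0_integralZl// => v _; exact: ltW.
have mSp := measurable_smear_start Q mG mW mJ m_rho rho_gt0' u mfp fp0.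
apply: (@le_trans _ _ (\int[leb (n := n)]_v
    ((a1 `^ (p - 1))%:E * S (fun z => f z `^ p)%R (u + v)))%E).
  apply: ge0_le_integral => //.
  - by move=> v _; rewrite mule_ge0// ltW.
  - exact: measurable_funeM.
  - exact: measurable_funeM.
rewrite ge0_integralZl//; first last.
- by rewrite lee_fin powR_ge0.
- by move=> v _; exact: S0.
rewrite integral_smear// QJ.
apply: (@le_trans _ _ ((a1 `^ (p - 1))%:E * (a1%:E * 1))%E).
  by rewrite !lee_wpmul2l// lee_fin// powR_ge0.
rewrite mule1 -EFinM poweR_EFin lee_fin -[X in _ * X]powRr1//.
rewrite -powRD ?subrK//.
by rewrite (gt_eqF (lt_trans ltr01 p_gt1)).
Qed.

End first_jump_smoothing.

Theorem theorem4p1 (R : realType) (n d : nat) (B : 'M[R]_(n, d))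
    (rankB : \rank B = n) :
  exists c : R, 0 < c /\
  forall (A : 'M[R]_n) (b : 'cV[R]_d) (Q : 'M[R]_d)
    (nu nu0 : {measure set 'cV[R]_d -> \bar R})
    (rho0 : 'cV[R]_d -> R) (lam0 : R)
    (dO : measure_display) (Omega : measurableType dO) (P : probability Omega R)
    (L L1 L0 : R -> Omega -> 'cV[R]_d)
    (X : 'cV[R]_n -> R -> Omega -> 'cV[R]_n),
  let P1t := P1 P X (fun w => first_jump_time (L0 ^~ w)) in
  nonneg_definite Q ->
  levy_measure nu ->
  measurable_fun setT rho0 ->
  (forall z, 0 < rho0 z) ->
  (forall E, measurable E ->
    nu0 E = (\int[lebesgue_cV R d]_(z in E) (rho0 z)%:E)%E) ->
  nu0 setT = lam0%:E ->
  0 < lam0 ->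
  (forall E, measurable E -> (nu0 E <= nu E)%E) ->
  levy_process P L ->
  generated_by P L (levy_generator b Q nu) ->
  compound_poisson P nu0 L0 ->
  generated_by P L0 (jump_generator nu0) ->
  levy_process P L1 ->
  generated_by P L1
    (fun f x => levy_generator b Q nu f x - jump_generator nu0 f x) ->
  independent_processes P L1 L0 ->
  {ae P, forall w, forall t, 0 <= t -> L t w = L1 t w + L0 t w} ->
  (forall x, solves_OU P A B L x (X x)) ->
  forall p : R, 1 < p ->
  (forall r, 0 <= r -> (V rho0 lam0 p r < +oo)%E) ->
  (forall f : 'cV[R]_n -> R, measurable_fun setT f -> (forall z, 0 <= f z) ->
    forall (x y : 'cV[R]_n) (t : R), 0 < t ->
    (P1t t f x `^ p <=
     P1t t (fun z => f z `^ p)%R y *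
     ((1 - expR (- (lam0 * t)))%:E *
      V rho0 lam0 p (c * expR (opnorm A * t) * enorm (x - y))) `^ (p - 1))%E) /\
  (* the power I^(-1/p) of I in [0, +oo] is written (I^-1)^(1/p), because
     [poweR] takes the value +oo, and not 0, at +oo for negative exponents *)
  (forall t : R, 0 < t ->
    let bound :=
      ((1 - expR (- (lam0 * t)))%:E * (expR (opnorm A * t / p))%:E *
       ((\int[lebesgue_cV R n]_x
           (V rho0 lam0 p (c * expR (opnorm A * t) * enorm x) `^ (p - 1))^-1)^-1)
         `^ p^-1)%E in
    (opnorm_Lp_Lq p%:E +oo (P1t t) <= bound)%E /\ (bound < +oo)%E).
Proof.
exists (1 + opnorm (pinvmx B)); split; first by rewrite ltr_pwDl// opnorm_ge0.
move=> A b Q nu nu0 rho0 lam0 dO Omega P L L1 L0 X P1t _ [nu00 _] mrho rho_gt0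
  nu0E nu0T lam0_gt0 nu0_nu levyL _ [mL0 [T [xi [mTxi Txi expT lawxi pathL0]]]]
  _ levyL1 _ indL sumL solX p p_gt1 V_fin.
have nu0_0 : nu0 [set 0] = 0%E.
  apply/eqP; rewrite eq_le measure_ge0 andbT -nu00.
  by apply: nu0_nu; exact: measurable_set1_cV.
have rho_lam : (\int[leb (n := d)]_z (rho0 z)%:E = lam0%:E)%E.
  by rewrite -nu0T nu0E.
have rep := representation mrho rho_gt0 nu0E nu0T lam0_gt0 nu0_0 levyL levyL1 mL0 indL
  sumL solX (fun i => (mTxi i).1) (fun i => (mTxi i).2) Txi expT lawxi pathL0.
have a0 t : 0 < t -> 0 <= 1 - expR (- (lam0 * t)).
  by move=> t0; rewrite subr_ge0 -expR0 ler_expR oppr_le0 mulr_ge0 ?ltW.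
have p_gt0 : 0 < p by exact: lt_trans p_gt1.
split=> [f mf f0 x y t t0|t t0 /=].
  have [W [tau [mW mtau QJ P1E _]]] := rep t t0.
  rewrite /P1t !P1E//; last 2 first.
  - exact: (measurableT_comp (measurable_powR _)).
  - by move=> z; exact: powR_ge0.
  exact: smear_flow_harnack.
have [W [tau [mW mtau QJ P1E P1norm]]] := rep t t0.
pose I := (\int[leb (n := n)]_v (V rho0 lam0 p
  ((1 + opnorm (pinvmx B)) * expR (opnorm A * t) * enorm v) `^ (p - 1))^-1)%E.
have I_gt0 : (0 < I)%E by exact: integral_Vinv_gt0.
have IV0 : (0 <= I^-1)%E by rewrite inve_ge0 ltW.
split; last first.
  rewrite lte_mul_pinfty// ?lee_fin ?mulr_ge0 ?a0 ?expR_ge0//.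
  by apply: poweR_lty; rewrite ltey inve_eqy gt_eqF.
apply: ge_ereal_sup => _ [f [mf f1] <-].
have P1_le x : (`|P1t t f x| <=
    (1 - expR (- (lam0 * t)))%:E * (expR (opnorm A * t / p))%:E * I^-1 `^ p^-1)%E.
  apply: le_trans (P1norm _ _ mf) _.
  have mnf : measurable_fun setT (fun z => `|f z|) by exact: measurableT_comp.
  rewrite P1E//.
  apply: (@le_trans _ _ ((1 - expR (- (lam0 * t)))%:E * I^-1 `^ p^-1)%E).
    apply: smear_sup_bound => //.
    have <- : (Lnorm (lebesgue_cV R n) p%:E (EFin \o f) `^ p =
        \int[lebesgue_cV R n]_v (`|f v| `^ p)%:E)%E.
      by rewrite poweR_Lnorm ?gt_eqF//; apply: eq_integral => v _; rewrite poweR_EFin.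
    rewrite -(poweR1r p); apply: gt0_ler_poweR => //; first exact: ltW.
      by rewrite in_itv /= leey Lnorm_ge0.
    by rewrite in_itv /= leey lee01.
  rewrite lee_wpmul2r ?poweR_ge0//.
  rewrite -EFinM lee_fin ler_peMr ?a0// -expR0 ler_expR.
  by rewrite divr_ge0 ?(ltW p_gt0)// mulr_ge0 ?opnorm_ge0// ltW.
rewrite unlock; case: ifP => _; first by apply/ess_supP/nearW => x; exact: P1_le.
by rewrite !mule_ge0// ?lee_fin ?a0 ?expR_ge0 ?poweR_ge0.
Qed.
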